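(* Let $A$ be a self-adjoint operator on a Hilbert space $\mathcal{H}$, let $\varphi\in\mathcal{H}_{-2}\setminus\mathcal{H}$, let $c\in\mathbb{R}$ be fixed, and let $A_{\alpha,c}=A+\alpha\langle\varphi_c,\cdot\rangle\varphi$ for $\alpha\in\mathbb{R}$. Let $\mathcal{M}$ be the cyclicity space of $(A-iI)^{-1}\varphi$. Then the set $$\Xi_c:=\{x\in\sigma(A\upharpoonright_{\mathcal{M}}) : x\notin\sigma_p(A_{\alpha,c}\upharpoonright_{\mathcal{M}})\text{ for any }\alpha\in\mathbb{R}\setminus\{0\}\}$$ contains a dense $G_\delta$ subset of $\sigma(A\upharpoonright_{\mathcal{M}})$.
   Context: $\mathcal{H}$ is a complex Hilbert space, with inner product conjugate-linear in the first argument. For $s\ge 0$, $\mathcal{H}_s=D(|A|^{s/2})$ with norm $\|x\|_s=\|(|A|+I)^{s/2}x\|$, and $\mathcal{H}_{-s}$ is the completion of $\mathcal{H}$ in the norm $\|(|A|+I)^{-s/2}x\|$, identified with the space of bounded functionals on $\mathcal{H}_s$; so $\mathcal{H}_2=D(A)$, and for $\varphi\in\mathcal{H}_{-2}$, $x\in\mathcal{H}_2$, $\langle\varphi,x\rangle$ is the duality pairing, extending the inner product by continuity. For $\varphi\in\mathcal{H}_{-2}$, $(A\pm iI)^{-1}\varphi\in\mathcal{H}$ is defined in the generalized sense: $\langle (A\pm iI)^{-1}\varphi,\eta\rangle=\langle\varphi,(A\mp iI)^{-1}\eta\rangle$ for all $\eta\in\mathcal{H}$. Put $A(A^2+I)^{-1}\varphi:=\frac12[(A-iI)^{-1}\varphi+(A+iI)^{-1}\varphi]\in\mathcal{H}$.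 Let $\varphi\in\mathcal{H}_{-2}\setminus\mathcal{H}$. The operator $\dot A:=A\upharpoonright_{D(\dot A)}$, $D(\dot A)=\{x\in D(A):\langle\varphi,x\rangle=0\}$, is a densely defined closed symmetric operator with deficiency indices $(1,1)$, and $D(\dot A^* )=D(A)\dotplus\mathrm{span}\{A(A^2+I)^{-1}\varphi\}$. For $c\in\mathbb{R}$, the functional $\varphi_c$ on $D(\dot A^* )$ extends $\varphi$ by $\langle\varphi_c,x+bA(A^2+I)^{-1}\varphi\rangle=\langle\varphi,x\rangle+bc$ for $x\in D(A)$, $b\in\mathbb{C}$. For $\alpha\in\mathbb{R}$ the formal expression $A_{\alpha,c}=A+\alpha\langle\varphi_c,\cdot\rangle\varphi$ denotes the self-adjoint operator obtained by restricting $\dot A^*$ to $$D(A_{\alpha,c})=\{x+bA(A^2+I)^{-1}\varphi : x\in D(A),\ b\in\mathbb{C},\ b+\alpha(\langle\varphi,x\rangle+bc)=0\}$$ (for $\alpha\ne0$ the condition reads $\langle\varphi,x\rangle=\gamma b$ with $\gamma=-(\frac1\alpha+c)$; and $A_{0,c}=A$). The cyclicity space of $(A-iI)^{-1}\varphi$ is $\mathcal{M}=\overline{\mathrm{span}\{(A-zI)^{-1}(A-iI)^{-1}\varphi: z\in\mathbb{C}\setminus\mathbb{R}\}}$. It reduces every $A_{\alpha,c}$ (and is unchanged if $A$ is replaced by $A_{\alpha,c}$ in the resolvents $(A-zI)^{-1}$); $A_{\alpha,c}\upharpoonright_{\mathcal{M}}$ is the self-adjoint operator on $\mathcal{M}$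 with domain $D(A_{\alpha,c})\cap\mathcal{M}$. $\sigma$ denotes spectrum and $\sigma_p$ the set of eigenvalues. *)

(* Defs.v *)
From HB Require Import structures.
From mathcomp Require Import all_boot all_order all_algebra.
From mathcomp Require Import complex.
From mathcomp Require Import all_classical all_reals all_analysis.
From mathcomp Require Import borel_hierarchy.
Set Implicit Arguments.
Unset Strict Implicit.
Unset Printing Implicit Defensive.
Import Order.TTheory GRing.Theory Num.Theory.
Import numFieldNormedType.Exports.
Local Open Scope classical_set_scope.
Local Open Scope ring_scope.
Local Open Scope complex_scope.

(* A Hilbert space is a complete normed module [H] over [R[i]] together with a
   positive definite hermitian form [ip] such that [`|x| ^+ 2 = ip x x].
   MathComp forms are linear in the first argument; [inner ip] is the same
   inner product, conjugate-linear in the first argument. *)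
Definition inner {R : realType} {H : completeNormedModType R[i]}
    (ip : {dot H for Num.conj}) (x y : H) : R[i] := ip y x.

Definition norm_of_inner {R : realType} {H : completeNormedModType R[i]}
    (ip : {dot H for Num.conj}) : Prop :=
  forall x : H, `|x| ^+ 2 = inner ip x x.

Definition is_subspace {R : realType} {H : completeNormedModType R[i]}
    (D : set H) : Prop :=
  D 0 /\ forall (a : R[i]) (x y : H), D x -> D y -> D (a *: x + y).

Definition lspan {R : realType} {H : completeNormedModType R[i]}
    (S : set H) : set H :=
  smallest is_subspace S.

(* The values of [app] outside [dom] are irrelevant. *)
Record operator (V : Type) := Operator { dom : set V; app :> V -> V }.

Definition op_eq {V : Type} (S T : operator V) : Prop :=
  dom S = dom T /\ forall x, dom T x -> S x = T x.

Definition op_restrict {V : Type} (T : operator V) (D : set V) : operator V :=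
  Operator (dom T `&` D) T.

Definition op_comp {V : Type} (S T : operator V) : operator V :=
  Operator [set x | dom T x /\ dom S (T x)] (fun x => S (T x)).

Definition linear_on {R : realType} {H : completeNormedModType R[i]}
    {W : lmodType R[i]} (D : set H) (f : H -> W) : Prop :=
  forall (a : R[i]) (x y : H), D x -> D y -> f (a *: x + y) = a *: f x + f y.

Definition linear_operator {R : realType} {H : completeNormedModType R[i]}
    (T : operator H) : Prop :=
  is_subspace (dom T) /\ linear_on (dom T) T.

(* For a densely defined [T] the vector [w] below is unique. *)
Definition adjoint {R : realType} {H : completeNormedModType R[i]}
    (ip : {dot H for Num.conj}) (T : operator H) : operator H :=
  let adj y := [set w : H |
    forall x, dom T x -> inner ip y (T x) = inner ip w x] in
  Operator [set y | adj y !=set0] (fun y => xget 0 (adj y)).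

Definition self_adjoint {R : realType} {H : completeNormedModType R[i]}
    (ip : {dot H for Num.conj}) (T : operator H) : Prop :=
  [/\ linear_operator T, dense (dom T) & op_eq (adjoint ip T) T].

(* [(T - z I)^-1 y] *)
Definition resolvent {R : realType} {H : completeNormedModType R[i]}
    (T : operator H) (z : R[i]) (y : H) : H :=
  xget 0 [set x | dom T x /\ T x - z *: x = y].

(* Here [T] is an operator of the closed subspace [M], i.e. its domain and its
   range lie in [M]; it is the Hilbert space [M] that [T - z I] has to map
   onto. *)
Definition resolvent_set {R : realType} {H : completeNormedModType R[i]}
    (M : set H) (T : operator H) : set R[i]^o :=
  [set z | set_bij (dom T) M (fun x => T x - z *: x) /\
    exists C : R, forall x, dom T x -> `|x| <= C%:C * `|T x - z *: x|].

Definition spectrum {R : realType} {H : completeNormedModType R[i]}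
    (M : set H) (T : operator H) : set R[i]^o :=
  ~` resolvent_set M T.

Definition point_spectrum {R : realType} {H : completeNormedModType R[i]}
    (T : operator H) : set R[i]^o :=
  [set z | exists x, [/\ dom T x, x != 0 & T x = z *: x]].

(* [B = |T|], the (unique) nonnegative self-adjoint square root of [T^* T]. *)
Definition is_abs {R : realType} {H : completeNormedModType R[i]}
    (ip : {dot H for Num.conj}) (T B : operator H) : Prop :=
  [/\ self_adjoint ip B,
      forall x, dom B x -> 0 <= inner ip x (B x) &
      op_eq (op_comp B B) (op_comp (adjoint ip T) T)].

(* The elements of [H_{-2}] are represented by the functionals [x |-> <phi, x>]
   on [H_2 = D(|A|) = D(A)], linear and bounded for the norm
   [|| (|A| + I) x ||]; values of [phi] outside [D(A)] are irrelevant. *)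
Definition Hminus2 {R : realType} {H : completeNormedModType R[i]}
    (ip : {dot H for Num.conj}) (A : operator H) : set (H -> R[i]) :=
  [set phi | exists absA : operator H,
    [/\ is_abs ip A absA,
        linear_on (W := R[i]^o) (dom absA) phi &
        exists C : R, forall x, dom absA x ->
          `|phi x| <= C%:C * `|absA x + x|]].

(* The elements of [H_{-2}] that come from the embedding of [H], which sends
   [h] to [x |-> <h, x>]. *)
Definition in_H {R : realType} {H : completeNormedModType R[i]}
    (ip : {dot H for Num.conj}) (A : operator H) : set (H -> R[i]) :=
  [set phi | exists h : H, forall x, dom A x -> phi x = inner ip h x].

(* [(A - z I)^-1 phi] for [phi] in [H_{-2}], in the generalized sense. *)
Definition gen_resolvent {R : realType} {H : completeNormedModType R[i]}
    (ip : {dot H for Num.conj}) (A : operator H) (phi : H -> R[i])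
    (z : R[i]) : H :=
  xget 0 [set h | forall eta : H,
    inner ip h eta = phi (resolvent A (Num.conj z) eta)].

(* [A (A^2 + I)^-1 phi] *)
Definition defect_vector {R : realType} {H : completeNormedModType R[i]}
    (ip : {dot H for Num.conj}) (A : operator H) (phi : H -> R[i]) : H :=
  2^-1 *: (gen_resolvent ip A phi 'i + gen_resolvent ip A phi (- 'i)).

Definition sym_restriction {R : realType} {H : completeNormedModType R[i]}
    (A : operator H) (phi : H -> R[i]) : operator H :=
  op_restrict A [set x | phi x = 0].

(* The value [<phi, x> + b c] of [phi_c] at [x + b A (A^2 + I)^-1 phi]. *)
Definition ext_functional {R : realType} {H : completeNormedModType R[i]}
    (phi : H -> R[i]) (c : R) (x : H) (b : R[i]) : R[i] :=
  phi x + b * c%:C.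

(* [A + alpha <phi_c, .> phi] *)
Definition perturbation {R : realType} {H : completeNormedModType R[i]}
    (ip : {dot H for Num.conj}) (A : operator H) (phi : H -> R[i])
    (c alpha : R) : operator H :=
  op_restrict (adjoint ip (sym_restriction A phi))
    [set y | exists (x : H) (b : R[i]),
      [/\ dom A x,
          y = x + b *: defect_vector ip A phi &
          b + alpha%:C * ext_functional phi c x b = 0]].

Definition cyclic_space {R : realType} {H : completeNormedModType R[i]}
    (A : operator H) (v : H) : set H :=
  closure (lspan [set resolvent A z v | z in [set z | z \isn't Num.real]]).

Definition Xi {R : realType} {H : completeNormedModType R[i]}
    (ip : {dot H for Num.conj}) (A : operator H) (phi : H -> R[i])
    (c : R) : set R[i]^o :=
  let M := cyclic_space A (gen_resolvent ip A phi 'i) in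
  [set x | spectrum M (op_restrict A M) x /\
    forall alpha : R, alpha != 0 ->
      ~ point_spectrum (op_restrict (perturbation ip A phi c alpha) M) x].

(* Main.v *)
Require Import Defs.
From HB Require Import structures.
From mathcomp Require Import all_boot all_order all_algebra.
From mathcomp Require Import complex.
From mathcomp Require Import all_classical all_reals all_analysis.
From mathcomp Require Import borel_hierarchy.
From mathcomp Require Import ring lra.
Set Implicit Arguments.
Unset Strict Implicit.
Unset Printing Implicit Defensive.
Import Order.TTheory GRing.Theory Num.Theory.
Import numFieldNormedType.Exports.
Local Open Scope classical_set_scope.
Local Open Scope ring_scope.
Local Open Scope complex_scope.

(** Let [g = (A - i)^-1 phi], so that [phi v = <g, (A + i) v>] on [D(A)], and let
    [T] be the part of [A] in the cyclic space [M] of [g]. The set [G] consists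
    of the points [z] at which no inequality [|phi v| <= n |(T - z) v|] holds on
    [D(T)]. It is a countable intersection of open sets, and it lies in the
    spectrum of [T], since [phi] is bounded for the graph norm.

    An eigenvector [y] in [M] of a perturbed operator at a real [x] satisfies
    [<y, (A - x) v> = k phi v] on [D(A)], because both sides vanish on the kernel
    of [phi] there. If [k <> 0], this bounds [phi] by [A - x]. If [k = 0], then
    [y] is an eigenvector of [A] in [M] annihilated by [phi], and there is none
    ([unbounded_not_eigenvalue]).

    It remains to see that [G] is dense in the spectrum. By Baire's argument it
    suffices that near a point of the spectrum no inequality with a fixed [n]
    holds at all spectral points. If it did on an interval [I], the spectral
    measure [mu] of [phi] would satisfy
    [int mu(dt) / (t - x)^2 <= n^2] for all spectral [x] in [I]; a piece of the
    spectrum of length [d] would then have mass at most [n^2 d^2], and cutting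
    [I] into small pieces would give mass 0, so that [I] contains no spectrum.

    Three steps replace the spectral theorem here. The inequality extends, with
    a larger constant, to all points of [I], because a resolvent is bounded by
    the inverse of the distance to the spectrum ([phi_bounded_near_regular]).
    The cutting of [I] is a statement about one vector [v]: if the equations
    [(T - s) u = v] have uniformly bounded solutions for [s] in (-1, 1), then
    [|v| <= |T v|]. It is proved in [bounded_solutions_gap] by summing over the
    zeros of the Chebyshev polynomials of degree [2^k], one doubling at a time.
    Finally the vectors with such solutions are dense for the graph norm, which
    gives a spectral gap ([phi_bounded_regular]). *)

(** * Real-valued norms and inner products *)

Section RealNorm.
Variable R : realType.

(** Norms of vectors are elements of [R[i]]; their real values are used
    throughout, since [R] is totally ordered. *)
Definition nrm (V : normedZmodType R[i]) (x : V) : R := complex.Re `|x|.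

Lemma normE (V : normedZmodType R[i]) (x : V) : `|x| = (nrm x)%:C.
Proof. by rewrite /nrm RRe_real // normr_real. Qed.

Lemma nrm_ge0 (V : normedZmodType R[i]) (x : V) : 0 <= nrm x.
Proof. by rewrite -ler0c -normE. Qed.

Lemma nrm0 (V : normedZmodType R[i]) : nrm (0 : V) = 0.
Proof. by rewrite /nrm normr0. Qed.

Lemma nrmN (V : normedZmodType R[i]) (x : V) : nrm (- x) = nrm x.
Proof. by rewrite /nrm normrN. Qed.

Lemma nrm_eq0 (V : normedZmodType R[i]) (x : V) : nrm x = 0 -> x = 0.
Proof. by move=> x0; apply/normr0_eq0; rewrite normE x0. Qed.

Lemma nrm_gt0 (V : normedZmodType R[i]) (x : V) : x != 0 -> 0 < nrm x.
Proof.
move=> x0; rewrite lt_neqAle nrm_ge0 andbT eq_sym.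
by apply: contra x0 => /eqP/nrm_eq0 ->.
Qed.

Lemma nrmD (V : normedZmodType R[i]) (x y : V) : nrm (x + y) <= nrm x + nrm y.
Proof. by rewrite -lecR rmorphD /= -!normE ler_normD. Qed.

Lemma nrmB (V : normedZmodType R[i]) (x y : V) : nrm (x - y) <= nrm x + nrm y.
Proof. by rewrite -(nrmN y) nrmD. Qed.

Lemma nrm_sub (V : normedZmodType R[i]) (x y : V) :
  nrm (x - y) = nrm (y - x).
Proof. by rewrite -nrmN opprB. Qed.

Lemma nrmM (a b : R[i]) : nrm (a * b) = nrm a * nrm b.
Proof. by apply: complexI; rewrite rmorphM /= -!normE normrM. Qed.

Lemma nrm_real (a : R) : nrm a%:C = `|a|.
Proof. by rewrite /nrm normc_def /= expr0n /= addr0 sqrtr_sqr. Qed.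

Lemma nrm_conj (a : R[i]) : nrm (conjc a) = nrm a.
Proof. by rewrite /nrm normcJ. Qed.

Lemma nrm_Re (a : R[i]) : `|complex.Re a| <= nrm a.
Proof. by rewrite -lecR -normE normc_ge_Re. Qed.

Lemma nrm_Im (a : R[i]) : `|complex.Im a| <= nrm a.
Proof.
rewrite /nrm normc_def /= -sqrtr_sqr ler_wsqrtr // lerDr; exact: sqr_ge0.
Qed.

Lemma nrmZ (H : normedModType R[i]) (a : R[i]) (x : H) :
  nrm (a *: x) = nrm a * nrm x.
Proof. by apply: complexI; rewrite rmorphM /= -!normE normrZ. Qed.

Lemma nrmZr (H : normedModType R[i]) (a : R) (x : H) :
  nrm (a%:C *: x) = `|a| * nrm x.
Proof. by rewrite nrmZ nrm_real. Qed.

(** Balls have radii in [R[i]]; the real radii already give a basis of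
    neighbourhoods. *)
Lemma nbhs_nrmP (V : normedModType R[i]) (x : V) (P : set V) :
  nbhs x P <-> exists2 e : R, 0 < e & forall y, nrm (x - y) < e -> P y.
Proof.
split.
  move=> /nbhs_normP[e /= e0 eP]; exists (complex.Re e).
    by move: e0; rewrite ltcE => /andP[].
  move=> y xy; apply: eP; rewrite /= normE.
  have -> : e = (complex.Re e)%:C by rewrite RRe_real // gtr0_real.
  by rewrite ltcR.
move=> [e e0 eP]; apply/nbhs_normP; exists e%:C; first by rewrite /= ltcR.
by move=> y /=; rewrite normE ltcR; apply: eP.
Qed.

Lemma closure_nrmP (V : normedModType R[i]) (S : set V) (x : V) :
  closure S x <-> forall e : R, 0 < e -> exists2 y, S y & nrm (x - y) < e.
Proof.
split=> [cSx e e0|h B].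
  have [|y [Sy xy]] := cSx [set y | nrm (x - y) < e].
    by apply/nbhs_nrmP; exists e.
  by exists y.
move=> /nbhs_nrmP[e e0 eB]; have [y Sy xy] := h e e0.
by exists y; split=> //; exact: eB.
Qed.

Lemma dense_nrmP (V : normedModType R[i]) (S : set V) (x : V) (e : R) :
  dense S -> 0 < e -> exists2 y, S y & nrm (x - y) < e.
Proof.
move=> dS; move: e; apply/closure_nrmP => B.
rewrite nbhsE => -[U [oU Ux] UB].
have [y [Uy Sy]] := dS U (ex_intro _ x Ux) oU.
by exists y; split=> //; exact: UB.
Qed.

Lemma open_nrmP (V : normedModType R[i]) (S : set V) :
  (forall x, S x -> exists2 e : R, 0 < e & forall y, nrm (x - y) < e -> S y) ->
  open S.
Proof. by move=> h; rewrite openE => x /h; exact: (nbhs_nrmP x S).2. Qed.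

Lemma cauchy_nrm (V : completeNormedModType R[i]) (u : nat -> V) :
  (forall e : R, 0 < e -> exists N, forall m n, (N <= m)%N -> (N <= n)%N ->
    nrm (u m - u n) < e) ->
  exists l, forall e : R, 0 < e ->
    exists N, forall n, (N <= n)%N -> nrm (l - u n) < e.
Proof.
move=> cu; have : cvg (u @ \oo).
  apply: cauchy_cvg; apply: cauchy_exP => e e0.
  have [|N hN] := cu (complex.Re e).
    by move: e0; rewrite ltcE => /andP[].
  exists (u N); exists N => // n /= Nn.
  rewrite -ball_normE /= normE.
  have -> : e = (complex.Re e)%:C by rewrite RRe_real // gtr0_real.
  by rewrite ltcR hN.
move=> /cvgrPdist_lt cl; exists (lim (u @ \oo)) => e e0.
have [|N _ hN] := cl e%:C; first by rewrite ltcR.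
by exists N => n Nn; have := hN n Nn; rewrite /= normE ltcR.
Qed.

Lemma le_eps (a b : R) : (forall e, 0 < e -> a <= b + e) -> a <= b.
Proof. by move=> h; apply/ler_addgt0Pr. Qed.

Lemma inv_succ_lt (e : R) : 0 < e ->
  exists N, forall n, (N <= n)%N -> n.+1%:R^-1 < e.
Proof.
move=> e0; exists (Num.truncn e^-1) => n Nn.
rewrite -[e]invrK ltf_pV2 ?posrE ?invr_gt0 //.
by apply: lt_le_trans (truncnS_gt _) _; rewrite ler_nat.
Qed.

Lemma conjc_i : conjc 'i%C = - 'i%C :> R[i].
Proof. by apply/eqP; rewrite eq_complex /= oppr0 !eqxx. Qed.

End RealNorm.

Section InnerProduct.
Variables (R : realType) (H : completeNormedModType R[i]).
Variable ip : {dot H for Num.conj}.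
Hypothesis ip_norm : norm_of_inner ip.

Lemma ipDl x y z : ip (x + y) z = ip x z + ip y z.
Proof. by rewrite linearDl. Qed.
Lemma ipDr x y z : ip z (x + y) = ip z x + ip z y.
Proof. by rewrite linearDr. Qed.
Lemma ipZl a x z : ip (a *: x) z = a * ip x z.
Proof. by rewrite linearZl_LR. Qed.
Lemma ipZr a x z : ip z (a *: x) = conjc a * ip z x.
Proof. by rewrite linearZr_LR. Qed.
Lemma ipNl x z : ip (- x) z = - ip x z.
Proof. by rewrite -scaleN1r ipZl mulN1r. Qed.
Lemma ipNr x z : ip z (- x) = - ip z x.
Proof. by rewrite -scaleN1r ipZr rmorphN rmorph1 mulN1r. Qed.
Lemma ipBl x y z : ip (x - y) z = ip x z - ip y z.
Proof. by rewrite ipDl ipNl. Qed.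
Lemma ipBr x y z : ip z (x - y) = ip z x - ip z y.
Proof. by rewrite ipDr ipNr. Qed.
Lemma ip0l z : ip 0 z = 0.
Proof. by rewrite -(scale0r 0) ipZl mul0r. Qed.
Lemma ip0r z : ip z 0 = 0.
Proof. by rewrite -(scale0r 0) ipZr rmorph0 mul0r. Qed.
Lemma ipC x y : ip x y = conjc (ip y x).
Proof. by rewrite hermC expr0 mul1r. Qed.

(** With real scalars alone this is a symmetric bilinear form, on which
    inequalities can be settled by real arithmetic. *)
Definition rip (x y : H) : R := complex.Re (ip x y).

Lemma ripDl x y z : rip (x + y) z = rip x z + rip y z.
Proof. by rewrite /rip ipDl raddfD. Qed.
Lemma ripZl (a : R) x z : rip (a%:C *: x) z = a * rip x z.
Proof. by rewrite /rip ipZl; case: (ip x z) => b d /=; rewrite mul0r subr0. Qed.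
Lemma ripC x y : rip x y = rip y x.
Proof. by rewrite /rip ipC; case: (ip y x). Qed.
Lemma ripDr x y z : rip z (x + y) = rip z x + rip z y.
Proof. by rewrite ripC ripDl ![rip _ z]ripC. Qed.
Lemma ripZr (a : R) x z : rip z (a%:C *: x) = a * rip z x.
Proof. by rewrite ripC ripZl ripC. Qed.
Lemma ripNl x z : rip (- x) z = - rip x z.
Proof. by rewrite /rip ipNl raddfN. Qed.
Lemma ripNr x z : rip z (- x) = - rip z x.
Proof. by rewrite ripC ripNl ripC. Qed.
Lemma ripBl x y z : rip (x - y) z = rip x z - rip y z.
Proof. by rewrite ripDl ripNl. Qed.
Lemma ripBr x y z : rip z (x - y) = rip z x - rip z y.
Proof. by rewrite ripDr ripNr. Qed.

Definition ripE := (ripDl, ripDr, ripNl, ripNr, ripZl, ripZr).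

Lemma rip_self x : rip x x = nrm x ^+ 2.
Proof.
have := ip_norm x; rewrite /inner normE -rmorphXn /= /rip => <- //=.
Qed.

Lemma rip_CS x y : rip x y <= nrm x * nrm y.
Proof.
have [->|y0] := eqVneq y 0.
  by rewrite nrm0 mulr0 /rip ip0r.
have ny := nrm_gt0 y0.
have := sqr_ge0 (nrm ((nrm y)%:C *: x - (nrm x)%:C *: y)).
rewrite -rip_self !ripE (ripC y x) !rip_self => h.
have [->|x0] := eqVneq x 0; first by rewrite nrm0 mul0r /rip ip0l.
have nx := nrm_gt0 x0.
have : 0 <= 2 * (nrm x * nrm y) * (nrm x * nrm y - rip x y) by nra.
by rewrite pmulr_rge0 ?subr_ge0 // !mulr_gt0.
Qed.

(** The complex inequality follows from the real one by rotating [x] so that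
    the inner product becomes its modulus. *)
Lemma ip_CS x y : nrm (ip x y) <= nrm x * nrm y.
Proof.
have [z0|z0] := eqVneq (ip x y) 0.
  by rewrite z0 nrm0 mulr_ge0 // nrm_ge0.
set z := ip x y in z0 *; have nz := nrm_gt0 z0.
have := rip_CS (conjc z *: x) y.
rewrite nrmZ nrm_conj -mulrA /rip ipZl -/z mulrC -sqr_normc normE.
by rewrite -rmorphXn /= expr2 ler_pM2l.
Qed.

Lemma rip_norm_CS x y : `|rip x y| <= nrm x * nrm y.
Proof. exact: le_trans (nrm_Re _) (ip_CS x y). Qed.

Lemma parallelogram (x y : H) :
  nrm (x - y) ^+ 2 = 2 * nrm x ^+ 2 + 2 * nrm y ^+ 2 - nrm (x + y) ^+ 2.
Proof. rewrite -!rip_self !ripE (ripC y x); ring. Qed.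

Lemma nrm_sqrB (x y : H) :
  nrm (x - y) ^+ 2 = nrm x ^+ 2 - 2 * rip x y + nrm y ^+ 2.
Proof. rewrite -!rip_self !ripE (ripC y x); ring. Qed.

Lemma nrm_sqrD (x y : H) :
  nrm (x + y) ^+ 2 = nrm x ^+ 2 + 2 * rip x y + nrm y ^+ 2.
Proof. rewrite -!rip_self !ripE (ripC y x); ring. Qed.

End InnerProduct.

(** * The Chebyshev gap lemma *)

Section Combinations.
Variables (K : fieldType) (V : lmodType K).

Definition comb (x y z u w : V) (a b c d e : K) : V :=
  a *: x + b *: y + c *: z + d *: u + e *: w.

Lemma combD x y z u w a b c d e a' b' c' d' e' :
  comb x y z u w a b c d e + comb x y z u w a' b' c' d' e' =
  comb x y z u w (a + a') (b + b') (c + c') (d + d') (e + e').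
Proof. by rewrite /comb !scalerDl; do !(rewrite addrACA; congr (_ + _)). Qed.
Lemma combZ x y z u w k a b c d e : k *: comb x y z u w a b c d e =
  comb x y z u w (k * a) (k * b) (k * c) (k * d) (k * e).
Proof. by rewrite /comb !scalerDr !scalerA. Qed.
Lemma combN x y z u w a b c d e : - comb x y z u w a b c d e =
  comb x y z u w (- a) (- b) (- c) (- d) (- e).
Proof. by rewrite -scaleN1r combZ !mulN1r. Qed.
Definition combE := (combN, combZ, combD).

Lemma comb_ind x y z u w (P : V -> V -> V -> V -> V -> Prop) :
  P (comb x y z u w 1 0 0 0 0) (comb x y z u w 0 1 0 0 0)
    (comb x y z u w 0 0 1 0 0) (comb x y z u w 0 0 0 1 0)
    (comb x y z u w 0 0 0 0 1) -> P x y z u w.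
Proof. by rewrite /comb !scale1r !scale0r !(addr0, add0r). Qed.

End Combinations.

(** Reduces an equation between linear combinations of the given vectors to
    equations between their coefficients. *)
Ltac comb_coefs :=
  rewrite !combE; congr (comb _ _ _ _ _ _ _ _ _ _);
  rewrite ?(mulr0, mulr1, mulrN1, mulrN, oppr0, opprK, addr0, add0r, subr0, sub0r);
  rewrite ?(subrr, addNr, addr0, add0r, oppr0, opprK); try by [].
Tactic Notation "lincomb" constr(x) constr(y) constr(z) :=
  pattern x, y, z;
  match goal with |- ?P x y z =>
    apply (@comb_ind _ _ x y z 0 0 (fun a b c _ _ => P a b c)) end; comb_coefs.
Tactic Notation "lincomb" constr(x) constr(y) constr(z) constr(u) :=
  pattern x, y, z, u;
  match goal with |- ?P x y z u =>
    apply (@comb_ind _ _ x y z u 0 (fun a b c d _ => P a b c d)) end; comb_coefs.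
Tactic Notation "lincomb" constr(x) constr(y) constr(z) constr(u) constr(w) :=
  pattern x, y, z, u, w;
  match goal with |- ?P x y z u w =>
    apply (@comb_ind _ _ x y z u w P) end; comb_coefs.

Section LinearOn.
Variables (R : realType) (H : completeNormedModType R[i]).

Lemma subspaceD (D : set H) x y : is_subspace D -> D x -> D y -> D (x + y).
Proof. by move=> [_ h] Dx Dy; rewrite -[x]scale1r; apply: h. Qed.
Lemma subspaceZ (D : set H) a x : is_subspace D -> D x -> D (a *: x).
Proof. by move=> [D0 h] Dx; rewrite -[_ *: _]addr0; apply: h. Qed.
Lemma subspaceN (D : set H) x : is_subspace D -> D x -> D (- x).
Proof. by move=> hD Dx; rewrite -scaleN1r; apply: subspaceZ. Qed.
Lemma subspaceB (D : set H) x y : is_subspace D -> D x -> D y -> D (x - y).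
Proof. by move=> hD Dx Dy; apply: subspaceD => //; apply: subspaceN. Qed.

Variable W : lmodType R[i].
Variables (D : set H) (f : H -> W).
Hypotheses (hD : is_subspace D) (hf : linear_on D f).

Lemma linear_on0 : f 0 = 0.
Proof.
have [D0 _] := hD; have := hf (-1) D0 D0.
by rewrite scaler0 add0r scaleN1r addNr.
Qed.
Lemma linear_onD x y : D x -> D y -> f (x + y) = f x + f y.
Proof. by move=> Dx Dy; rewrite -{1}[x]scale1r hf // scale1r. Qed.
Lemma linear_onZ a x : D x -> f (a *: x) = a *: f x.
Proof.
move=> Dx; rewrite -{1}[_ *: _]addr0 hf //; last by case: hD.
by rewrite linear_on0 addr0.
Qed.
Lemma linear_onN x : D x -> f (- x) = - f x.
Proof. by move=> Dx; rewrite -(scaleN1r x) linear_onZ // scaleN1r. Qed.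
Lemma linear_onB x y : D x -> D y -> f (x - y) = f x - f y.
Proof.
by move=> Dx Dy; rewrite linear_onD ?linear_onN //; apply: subspaceN.
Qed.

End LinearOn.

Section Chebyshev.
Variables (R : realType) (H : completeNormedModType R[i]).
Variable ip : {dot H for Num.conj}.
Hypothesis ip_norm : norm_of_inner ip.
Local Notation rip := (rip ip).

Definition symmetric_op (S : operator H) := forall x y,
  dom S x -> dom S y -> rip (S x) y = rip x (S y).

(** [T_{2n} = 2 T_n^2 - 1] for the Chebyshev polynomials. *)
Definition double_op (S : operator H) : operator H :=
  Operator [set x | dom S x /\ dom S (S x)] (fun x => 2%:C *: S (S x) - x).

(** The facts about [S = T_n(T)] that pass from [n] to [2 n]. The last one
    says that [(1 - t^2) (1 - T_n(t)^2)], which is the square of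
    [(1 - t^2) U_{n-1}(t)], is nonnegative; it is kept in terms of norms because
    the vectors in question lie only in the domains that occur in it. *)
Record chebyshev_of (T S : operator H) : Prop := ChebyshevOf {
  cheb_lin : linear_operator S;
  cheb_sym : symmetric_op S;
  cheb_dom : dom S `<=` dom T;
  cheb_comm : forall x, dom S x -> dom T (S x) ->
    dom S (T x) /\ S (T x) = T (S x);
  cheb_pos : forall x, dom S x -> dom T (S x) ->
    0 <= nrm x ^+ 2 - nrm (T x) ^+ 2 - nrm (S x) ^+ 2 + nrm (T (S x)) ^+ 2 }.

Lemma chebyshev_of_id (T : operator H) :
  linear_operator T -> symmetric_op T -> chebyshev_of T T.
Proof.
move=> lT sT; split=> // x Dx DTx.
have := sqr_ge0 (nrm (x - T (T x))).
by rewrite (nrm_sqrB ip_norm) -(sT _ _ Dx DTx) (rip_self ip_norm); lra.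
Qed.

Lemma double_linear (S : operator H) :
  linear_operator S -> linear_operator (double_op S).
Proof.
move=> [hD hS]; have hl := linear_onD hS; split.
  split=> [|a x y [Dx DSx] [Dy DSy]] /=.
    by rewrite (linear_on0 hD hS); case: hD.
  by rewrite hS //; split; apply: hD.2.
move=> a x y [Dx DSx] [Dy DSy] /=; rewrite hS // hS // !scalerDr scalerN.
by rewrite !scalerA (mulrC a) opprD addrACA.
Qed.

(** For the last field, [1 - (2 s^2 - 1)^2 = 4 s^2 (1 - s^2)] expresses the new
    quantity at [x] as four times the old one at [S x]. *)
Lemma chebyshev_of_double (T S : operator H) : linear_operator T ->
  chebyshev_of T S -> chebyshev_of T (double_op S).
Proof.
move=> [hT lT] [lS sS dS cS pS]; have [hD hS] := lS.
have mid x : dom S x -> dom S (S x) -> dom T (double_op S x) -> dom T (S (S x)).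
  move=> Dx DSx /= DT.
  have -> : S (S x) = 2^-1%:C *: ((2%:C *: S (S x) - x) + x).
    by rewrite subrK scalerA -rmorphM /= mulVf ?scale1r // pnatr_eq0.
  by apply: subspaceZ => //; apply: subspaceD => //; apply: dS.
split.
- exact: double_linear.
- move=> x y [Dx DSx] [Dy DSy] /=.
  by rewrite !(ripBl, ripBr, ripZl, ripZr) (sS _ _ DSx Dy) (sS _ _ Dx DSy).
- by move=> x [/dS].
- move=> x [Dx DSx] DT; have DTSS := mid x Dx DSx DT.
  have [D1 E1] := cS _ DSx DTSS; have [D2 E2] := cS _ Dx (dS _ DSx).
  split=> /=; first by rewrite E2.
  rewrite E2 E1 (linear_onB hT lT) //.
  + by rewrite (linear_onZ hT lT).
  + exact: subspaceZ.
  + exact: dS.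
- move=> x [Dx DSx] DT; have DTSS := mid x Dx DSx DT.
  have [D1 E1] := cS _ DSx DTSS; have [D2 E2] := cS _ Dx (dS _ DSx).
  have := pS _ DSx DTSS => /=.
  rewrite (linear_onB hT lT); first last.
  + exact: dS.
  + exact: subspaceZ.
  rewrite (linear_onZ hT lT) // -!(rip_self ip_norm).
  rewrite !(ripBl, ripBr, ripZl, ripZr).
  have -> : rip (S (S x)) x = rip (S x) (S x) by rewrite sS.
  have -> : rip x (S (S x)) = rip (S x) (S x) by rewrite sS.
  have e : rip (T (S (S x))) (T x) = rip (T (S x)) (T (S x)).
    by rewrite -E1 sS // E2.
  rewrite (ripC ip (T x)) e; lra.
Qed.

(** [b] bounds [<(1 - s S) y, y>] where [y = (S - s)^-1 v]. For [S = T_n(T)] and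
    [s = 0] this number is [<T_n(T)^-2 v, v>], and Fejer's identity
    [1 / T_n(t)^2 = n^-2 * sum_j (1 - t x_j) / (t - x_j)^2], with [x_j] the zeros
    of [T_n], expresses it by the same numbers for [n = 1] and [s = x_j]: it is
    of order [1 / n]. The free parameter [s] allows an induction on [n]. *)
Definition fejer_bound (S : operator H) (v : H) (b : R) := forall s : R,
  -1 < s -> s < 1 -> exists y, [/\ dom S y, S y - s%:C *: y = v &
    nrm y ^+ 2 - s * rip (S y) y <= b].

(** For [2 a^2 - 1 = s] the number that belongs to [2 S^2 - 1] and [s] is a
    quarter of the sum of those that belong to [S] and to [a] and [- a]. *)
Lemma fejer_bound_double (S : operator H) (v : H) (b : R) :
  linear_operator S -> symmetric_op S ->
  fejer_bound S v b -> fejer_bound (double_op S) v (b / 2).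
Proof.
move=> [hD hS] sS fS s s1 s2.
pose a := Num.sqrt ((1 + s) / 2).
have a2 : a ^+ 2 = (1 + s) / 2 by rewrite sqr_sqrtr //; lra.
have a0 : 0 < a by rewrite sqrtr_gt0; lra.
have a1 : a < 1 by nra.
have [||y1 [D1 E1 B1]] := fS a; [lra | lra |].
have [||y2 [D2 E2 B2]] := fS (- a); [lra | lra |].
have F1 : S y1 = v + a%:C *: y1 by rewrite -E1 subrK.
have F2 : S y2 = v - a%:C *: y2.
  by rewrite -[X in X - _]E2 rmorphN scaleNr opprK addrK.
have aC : a%:C != 0 :> R[i] by rewrite fmorph_eq0 gt_eqF.
have Dd : dom S (y1 - y2) by exact: subspaceB.
(* From [1 / (2 (t^2 - a^2)) = (1 / (t - a) - 1 / (t + a)) / (4 a)]. *)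
pose w := (4 * a)^-1%:C *: (y1 - y2).
have Sw : S w = 4^-1%:C *: (y1 + y2).
  rewrite /w (linear_onZ hD hS) // (linear_onB hD hS) // F1 F2.
  rewrite opprD opprK addrACA subrr add0r -scalerDr scalerA -rmorphM /=.
  by congr (_%:C *: _); field; rewrite gt_eqF.
have SSw : S (S w) = 4^-1%:C *: (v + a%:C *: y1 + (v - a%:C *: y2)).
  rewrite Sw (linear_onZ hD hS) ?(linear_onD hS) ?F1 ?F2 //.
  exact: subspaceD.
have dw : double_op S w = v + s%:C *: w.
  have s_def : s%:C = (2 * a ^+ 2 - 1)%:C by congr (_%:C); rewrite a2; field.
  rewrite /= SSw /w s_def.
  rewrite !(rmorphB, rmorphM, rmorphXn, fmorphV, rmorph1, rmorph_nat) /=.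
  by lincomb v y1 y2; field => //.
exists w; split.
- split; first exact: subspaceZ.
  by rewrite Sw; apply: subspaceZ => //; apply: subspaceD.
- by rewrite dw addrK.
- rewrite dw.
  have sym := sS _ _ D1 D2; move: B1 B2 sym.
  rewrite F1 F2 /w -!(rip_self ip_norm) !(ripBl, ripBr, ripDl, ripDr, ripZl, ripZr).
  rewrite !(ripNl, ripNr, ripZl, ripZr) !(ripC ip _ v) (ripC ip y2 y1).
  have -> : s = 2 * a ^+ 2 - 1 by rewrite a2; field.
  move: (rip y1 y1) (rip y2 y2) (rip y1 y2) (rip v y1) (rip v y2).
  move=> p q r f e B1 B2 sym.
  have -> : r = (f - e) / (2 * a).
    have -> : f - e = 2 * a * r by lra.
    by field; rewrite gt_eqF.
  (* The terms in [f - e] combine with the coefficient [- a / 4]. *)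
  set lhs := (X in X <= _).
  have -> : lhs = ((p - a * (f + a * p)) + (q - - a * (e - a * q))) / 4.
    by rewrite /lhs; field; rewrite gt_eqF.
  lra.
Qed.

(** If [v = T_n(T) w], then [|v|^2 - |T v|^2 <= |w|^2] by the positivity above,
    while [|w|^2] is of order [1 / n]. In terms of the spectral measure of [v]:
    if the integral of [1 / (t - s)^2] is bounded uniformly for [s] in (-1, 1),
    there is no mass in (-1, 1). *)
Lemma bounded_solutions_gap (T : operator H) (v : H) (b : R) :
  linear_operator T -> symmetric_op T -> dom T v ->
  (forall s : R, -1 < s -> s < 1 ->
    exists y, [/\ dom T y, T y - s%:C *: y = v & nrm y <= b]) ->
  nrm v <= nrm (T v).
Proof.
move=> lT sT Dv hb.
pose B := b ^+ 2 + b * nrm v.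
have step k : exists S, chebyshev_of T S /\ fejer_bound S v (B / 2 ^+ k).
  elim: k => [|k [S [cS fS]]]; last first.
    exists (double_op S); split; first exact: chebyshev_of_double.
    rewrite exprSr invfM mulrA; apply: fejer_bound_double => //.
      exact: cheb_lin cS.
    exact: cheb_sym cS.
  exists T; split; first exact: chebyshev_of_id.
  move=> s s1 s2; have [y [Dy Ey yb]] := hb s s1 s2; exists y; split=> //.
  have -> : T y = v + s%:C *: y by rewrite -Ey subrK.
  rewrite ripDl ripZl (rip_self ip_norm) expr0 divr1 /B.
  have y0 := nrm_ge0 y.
  have h1 := rip_CS ip_norm v y; have h2 := rip_CS ip_norm (- v) y.
  rewrite nrmN ripNl in h2.
  have h3 : nrm v * nrm y <= nrm v * b by rewrite ler_wpM2l // nrm_ge0.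
  have h4 : nrm y ^+ 2 <= b ^+ 2 by rewrite lerXn2r // nnegrE (le_trans y0).
  have h5 : 0 <= s ^+ 2 * nrm y ^+ 2 by rewrite mulr_ge0 // sqr_ge0.
  have h6 : - s * rip v y <= nrm v * nrm y.
    by have := nrm_ge0 v; nra.
  rewrite mulrDr mulrA -expr2; lra.
suff : nrm v ^+ 2 <= nrm (T v) ^+ 2 by rewrite ler_sqr ?nnegrE ?nrm_ge0.
apply: le_eps => e e0.
have [k hk] : exists k, B / 2 ^+ k < e.
  exists (Num.truncn (B / e)).+1.
  rewrite ltr_pdivrMr ?exprn_gt0 // mulrC -ltr_pdivrMr //.
  apply: lt_le_trans (truncnS_gt _) _.
  by rewrite -natrX ler_nat ltnW // ltn_expl.
have [S [cS fS]] := step k.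
have [||w [Dw Ew Bw]] := fS 0; [lra | lra |].
rewrite scale0r subr0 in Ew; rewrite mul0r subr0 in Bw.
have := cheb_pos cS Dw; rewrite Ew => /(_ Dv).
have := sqr_ge0 (nrm (T w)); lra.
Qed.
End Chebyshev.

(** * Riesz representation on a subspace *)

Section Riesz.
Variables (R : realType) (H : completeNormedModType R[i]).
Variable ip : {dot H for Num.conj}.
Hypothesis ip_norm : norm_of_inner ip.
Local Notation rip := (rip ip).

Lemma sqr_le_eps (a b : R) : 0 <= a -> 0 <= b ->
  (forall e, 0 < e -> a ^+ 2 <= a * b + e) -> a <= b.
Proof.
move=> a0 b0 h; have : a ^+ 2 <= a * b by apply: le_eps.
have [->//|an0] := eqVneq a 0.
by rewrite expr2 ler_pM2l // lt_neqAle eq_sym an0.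
Qed.

(** [Im z = - Re ('i z)], so real parts suffice on a complex subspace. *)
Lemma Re_ext (K : set H) (f g : H -> R[i]) : is_subspace K ->
  (forall x, K x -> f ('i%C *: x) = 'i%C * f x) ->
  (forall x, K x -> g ('i%C *: x) = 'i%C * g x) ->
  (forall x, K x -> complex.Re (f x) = complex.Re (g x)) ->
  forall x, K x -> f x = g x.
Proof.
move=> hK hf hg h x Kx; have := h _ Kx; have := h _ (subspaceZ 'i%C hK Kx).
rewrite hf // hg //; case: (f x) (g x) => a b [c d] /= h1 h2.
by congr (_ +i* _) => //; lra.
Qed.

(** The representing vector minimizes [|k|^2 - 2 Re (l k)]. The minimum may be
    attained only in the closure of [K]; a minimizing sequence in [K] is Cauchy
    by the parallelogram law. *)
Lemma riesz (K : set H) (l : H -> R[i]) (C : R) :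
  is_subspace K -> linear_on (W := R[i]^o) K l -> 0 <= C ->
  (forall k, K k -> nrm (l k) <= C * nrm k) ->
  exists y, [/\ closure K y, forall k, K k -> l k = ip k y & nrm y <= C].
Proof.
move=> hK hl C0 lC; have K0 := hK.1.
pose J k := nrm k ^+ 2 - 2 * complex.Re (l k).
have reD x y : K x -> K y -> complex.Re (l (x + y)) = complex.Re (l x) + complex.Re (l y).
  by move=> Kx Ky; rewrite (linear_onD hl) // raddfD.
have reZ (t : R) x : K x -> complex.Re (l (t%:C *: x)) = t * complex.Re (l x).
  move=> Kx; rewrite (linear_onZ hK hl) // /GRing.scale /=.
  by case: (l x) => p q /=; rewrite mul0r subr0.
have Jlb k : K k -> - C ^+ 2 <= J k.
  move=> Kk; have := le_trans (nrm_Re (l k)) (lC _ Kk).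
  rewrite ler_norml => /andP[_ h]; have := sqr_ge0 (nrm k - C).
  rewrite /J; nra.
pose E := [set J k | k in K].
have hE : has_inf E.
  split; first by exists (J 0), 0.
  by exists (- C ^+ 2) => _ [k Kk <-]; apply: Jlb.
pose m := inf E.
have mJ k : K k -> m <= J k by move=> Kk; apply: ge_inf; [case: hE | exists k].
have near_m e : 0 < e -> exists2 k, K k & J k < m + e.
  by move=> e0; have [_ [k Kk <-] ?] := inf_adherent e0 hE; exists k.
have mid x y e : K x -> K y -> J x < m + e -> J y < m + e ->
    nrm (x - y) ^+ 2 <= 4 * e.
  move=> Kx Ky Jx Jy; have Kxy := subspaceD hK Kx Ky.
  have := mJ _ (subspaceZ 2^-1%:C hK Kxy).
  move: Jx Jy; rewrite /J nrmZr ger0_norm ?invr_ge0 // reZ // reD //.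
  rewrite (parallelogram ip_norm) exprMn; lra.
have ex_u (n : nat) : exists k, K k /\ J k < m + n.+1%:R^-1.
  by have [|k Kk Jk] := near_m n.+1%:R^-1; [rewrite invr_gt0 | exists k].
have [u hu] := choice ex_u.
have ulim (e : R) : 0 < e -> exists N, forall n, (N <= n)%N -> J (u n) < m + e.
  move=> e0; have [N hN] := inv_succ_lt e0; exists N => n Nn.
  by have [_ /lt_trans->//] := hu n; rewrite ltrD2l hN.
have [|y hy] := @cauchy_nrm _ _ u.
  move=> e e0; have [|N hN] := ulim (e ^+ 2 / 8); first by rewrite divr_gt0 ?exprn_gt0.
  exists N => i j Ni Nj.
  have := mid _ _ _ (hu i).1 (hu j).1 (hN i Ni) (hN j Nj).
  have := nrm_ge0 (u i - u j); nra.
have approx (e : R) : 0 < e -> exists n, J (u n) < m + e /\ nrm (y - u n) < e.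
  move=> e0; have [N1 h1] := hy e e0; have [N2 h2] := ulim e e0.
  by exists (maxn N1 N2); rewrite h1 ?h2 // ?leq_maxl ?leq_maxr.
have var k (t : R) : K k -> 0 <= 2 * t * (rip k y - complex.Re (l k)) + t ^+ 2 * nrm k ^+ 2.
  move=> Kk; apply: le_eps => e e0.
  pose M := 1 + 2 * `|t| * nrm k.
  have M0 : 0 < M by have := normr_ge0 t; have := nrm_ge0 k; rewrite /M; nra.
  have [|n [Jn yn]] := approx (e / M); first by rewrite divr_gt0.
  have Kn := (hu n).1; have Ktk := subspaceZ t%:C hK Kk.
  have := mJ _ (subspaceD hK Kn Ktk).
  rewrite /J (nrm_sqrD ip_norm) ripZr nrmZr exprMn real_normK ?num_real //.
  rewrite reD // reZ // => h.
  have h1 : t * rip (u n) k <= t * rip k y + `|t| * nrm k * (e / M).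
    rewrite -lerBlDl -mulrBr (ripC ip k) -ripBl.
    apply: le_trans (ler_norm _) _; rewrite normrM -mulrA ler_wpM2l //.
    apply: le_trans (rip_norm_CS ip_norm _ _) _; rewrite nrm_sub.
    by rewrite mulrC ler_wpM2l ?nrm_ge0 // ltW.
  have h2 : e = e / M + 2 * (`|t| * nrm k * (e / M)).
    by rewrite /M; field; rewrite gt_eqF.
  rewrite /J in Jn; lra.
have re_eq k : K k -> complex.Re (l k) = rip k y.
  move=> Kk; apply/eqP; rewrite -subr_eq0 -oppr_eq0 opprB; apply/eqP.
  set d := rip k y - _; suff h : d ^+ 2 <= 0.
    by apply/eqP; rewrite -sqrf_eq0 eq_le h sqr_ge0.
  have [k0|k0] := eqVneq (nrm k ^+ 2) 0.
    by have := var k (- d) Kk; rewrite -/d k0; lra.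
  have k1 : 0 < nrm k ^+ 2 by rewrite lt_neqAle eq_sym k0 sqr_ge0.
  have := var k (- d / nrm k ^+ 2) Kk; rewrite -/d.
  have -> : 2 * (- d / nrm k ^+ 2) * d + (- d / nrm k ^+ 2) ^+ 2 * nrm k ^+ 2
     = - (d ^+ 2 / nrm k ^+ 2).
    by field; move: k0; rewrite sqrf_eq0.
  by rewrite oppr_ge0 pmulr_lle0 ?invr_gt0.
have rep k : K k -> l k = ip k y.
  apply: (@Re_ext K l (fun k => ip k y)) => // x Kx; last by rewrite ipZl.
  by rewrite (linear_onZ hK hl).
exists y; split=> //.
  apply/closure_nrmP => e e0; have [n [_ ?]] := approx e e0.
  by exists (u n) => //; exact: (hu n).1.
apply: sqr_le_eps => // [|e e0]; first exact: nrm_ge0.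
pose M := nrm y + C + 1.
have M0 : 0 < M by have := nrm_ge0 y; rewrite /M; lra.
have [|n [_ yn]] := approx (e / M); first by rewrite divr_gt0.
have -> : nrm y ^+ 2 = rip (y - u n) y + rip (u n) y.
  by rewrite -ripDl subrK (rip_self ip_norm).
have h1 : rip (y - u n) y <= e / M * nrm y.
  apply: le_trans (rip_CS ip_norm _ _) _.
  by rewrite ler_wpM2r ?nrm_ge0 // ltW.
have h2 : rip (u n) y <= C * nrm (u n).
  rewrite -re_eq ?(hu n).1 //; last exact: (hu n).1.
  by apply: le_trans (ler_norm _) (le_trans (nrm_Re _) (lC _ (hu n).1)).
have h3 : nrm (u n) <= nrm y + e / M.
  have -> : u n = y - (y - u n) by rewrite subKr.
  by apply: le_trans (nrmB _ _) _; rewrite lerD2l ltW.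
have h4 : C * nrm (u n) <= C * nrm y + C * (e / M).
  by rewrite -mulrDr ler_wpM2l.
have h5 : e = e / M * nrm y + C * (e / M) + e / M.
  by rewrite /M; field; rewrite gt_eqF.
have : 0 < e / M by rewrite divr_gt0.
lra.
Qed.

End Riesz.

(** * Operators self-adjoint in a closed subspace *)

Section SelfAdjoint.
Variables (R : realType) (H : completeNormedModType R[i]).
Variable ip : {dot H for Num.conj}.
Hypothesis ip_norm : norm_of_inner ip.
Local Notation rip := (rip ip).

Lemma nrm_small0 (V : normedZmodType R[i]) (a : V) (K : R) :
  (forall e, 0 < e -> nrm a <= K * e) -> a = 0.
Proof.
move=> h; apply/nrm_eq0/eqP; rewrite eq_le nrm_ge0 andbT; apply: le_eps => e e0.
have M0 : 0 < `|K| + 1 by rewrite ltr_wpDl.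
have e1 : 0 < e / (`|K| + 1) by rewrite divr_gt0.
apply: le_trans (h _ e1) _; rewrite add0r mulrA ler_pdivrMr // mulrC.
by rewrite ler_pM2l // ler_wpDr // ler_norm.
Qed.

Lemma orth_closure0 (S : set H) m :
  closure S m -> (forall x, S x -> ip x m = 0) -> m = 0.
Proof.
move=> /closure_nrmP Sm orth; apply/eqP; apply: contraT => m0.
have nm := nrm_gt0 m0; have [x Sx mx] := Sm _ nm.
have : nrm m ^+ 2 <= nrm (m - x) * nrm m.
  rewrite -(rip_self ip_norm) -[X in rip X _](subrK x) ripDl -[rip x m]/(complex.Re (ip x m)) orth //.
  by rewrite addr0 (rip_CS ip_norm).
by rewrite expr2 ler_pM2r // leNgt mx.
Qed.

Lemma orth_closure (S : set H) m y :
  (forall x, S x -> ip x m = 0) -> closure S y -> ip y m = 0.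
Proof.
move=> orth /closure_nrmP Sy; apply: (@nrm_small0 _ _ (nrm m)) => e e0.
have [x Sx yx] := Sy e e0.
rewrite -[y](subrK x) ipDl (orth x) // addr0 mulrC.
by apply: le_trans (ip_CS ip_norm _ _) _; rewrite ler_wpM2r ?nrm_ge0 // ltW.
Qed.

(** Self-adjointness of [T] in the Hilbert space formed by the closed subspace
    [M], so that the same results apply to [A] and to its part in [M]. *)
Record selfadjoint_in (M : set H) (T : operator H) : Prop := SelfAdjointIn {
  sa_sub : is_subspace M;
  sa_closed : closure M `<=` M;
  sa_lin : linear_operator T;
  sa_dom : dom T `<=` M;
  sa_ran : forall x, dom T x -> M (T x);
  sa_dense : M `<=` closure (dom T);
  sa_sym : forall x y, dom T x -> dom T y -> ip (T x) y = ip x (T y);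
  sa_adj : forall y w, M y -> M w ->
    (forall x, dom T x -> ip (T x) y = ip x w) -> dom T y /\ T y = w }.

Definition bounded_below (T : operator H) (z : R[i]) (c : R) :=
  forall x, dom T x -> c * nrm x <= nrm (T x - z *: x).

(** For nonreal [z], and for real [z] by [regular_surj], this amounts to
    membership in the resolvent set. *)
Definition regular (T : operator H) (z : R[i]) :=
  exists2 c : R, 0 < c & bounded_below T z c.

Lemma bounded_below_shift (T : operator H) (z w : R[i]) (c : R) :
  bounded_below T z c -> bounded_below T w (c - nrm (w - z)).
Proof.
move=> h x Dx; rewrite mulrBl lerBlDr -nrmZ.
have -> : T x - w *: x = T x - z *: x - (w - z) *: x.
  by rewrite scalerBl opprB addrA subrK.
apply: le_trans (h x Dx) _.
by rewrite -{1}[T x - z *: x](subrK ((w - z) *: x)) nrmD.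
Qed.

Section Fixed.
Variables (M : set H) (T : operator H).
Hypothesis saT : selfadjoint_in M T.
Let hD := (sa_lin saT).1.
Let hT := (sa_lin saT).2.
Let hM := sa_sub saT.

Lemma sa_symmetric_op : symmetric_op ip T.
Proof. by move=> x y Dx Dy; rewrite /rip (sa_sym saT). Qed.

(** [<T x, x>] is real, so the imaginary part of [<(T - z) x, x>] is
    [- Im z |x|^2]. *)
Lemma nonreal_bounded_below (z : R[i]) :
  bounded_below T z `|complex.Im z|.
Proof.
move=> x Dx; have [->|x0] := eqVneq x 0; first by rewrite nrm0 mulr0 nrm_ge0.
have nx := nrm_gt0 x0; rewrite -(ler_pM2r nx).
apply: le_trans (ip_CS ip_norm _ _); apply: le_trans (nrm_Im _).
have re : complex.Im (ip (T x) x) = 0.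
  have : ip (T x) x = conjc (ip (T x) x) by rewrite -ipC (sa_sym saT).
  by case: (ip _ _) => a b [] /=; lra.
have xx : ip x x = (nrm x ^+ 2)%:C by have := ip_norm x; rewrite /inner => <-; rewrite normE rmorphXn.
rewrite ipBl raddfB /= re ipZl xx sub0r normrN.
case: z => a b /=; rewrite mulr0 add0r normrM.
by rewrite -mulrA -expr2 [X in _ <= _ * X]ger0_norm ?sqr_ge0.
Qed.

Lemma sa_closed_graph x y :
  (forall e : R, 0 < e ->
     exists u, [/\ dom T u, nrm (x - u) < e & nrm (y - T u) < e]) ->
  dom T x /\ T x = y.
Proof.
move=> h; apply: (sa_adj saT).
- apply: (sa_closed saT); apply/closure_nrmP => e /h[u [Du xu _]].
  by exists u => //; apply: (sa_dom saT).
- apply: (sa_closed saT); apply/closure_nrmP => e /h[u [Du _ yu]].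
  by exists (T u) => //; apply: (sa_ran saT).
move=> v Dv; apply/eqP; rewrite -subr_eq0; apply/eqP.
apply: (@nrm_small0 _ _ (nrm (T v) + nrm v)) => e /h[u [Du xu yu]].
have -> : ip (T v) x - ip v y = ip (T v) (x - u) - ip v (y - T u).
  by rewrite !ipBr (sa_sym saT Dv Du); ring.
apply: le_trans (nrmB _ _) _; rewrite mulrDl.
by apply: lerD; apply: le_trans (ip_CS ip_norm _ _) _;
  rewrite ler_wpM2l ?nrm_ge0 // ltW.
Qed.

(** The range is closed because [T] is closed and bounded below; a vector
    orthogonal to it would be an eigenvector for the conjugate of [z], which is
    regular too. *)
Lemma regular_surj (z : R[i]) (f : H) : regular T z -> regular T (conjc z) ->
  M f -> exists x, dom T x /\ T x - z *: x = f.
Proof.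
move=> [c c0 bc] [c' c'0 bc'] Mf.
pose K := [set T x - z *: x | x in dom T].
have hK : is_subspace K.
  split; first by exists 0; [exact: hD.1 | rewrite (linear_on0 hD hT) scaler0 subr0].
  move=> a _ _ [x Dx <-] [y Dy <-]; exists (a *: x + y); first exact: hD.2.
  by rewrite hT // scalerBr scalerDr !scalerA (mulrC z) opprD addrACA.
have KM : K `<=` M.
  move=> _ [x Dx <-]; apply: subspaceB => //; first exact: (sa_ran saT).
  by apply: subspaceZ => //; exact: (sa_dom saT).
have [||k _|y [Ky ly _]] := @riesz _ _ ip ip_norm K (fun k => ip k f) (nrm f) hK.
- by move=> a x y _ _; rewrite ipDl ipZl.
- exact: nrm_ge0.
- by rewrite mulrC (ip_CS ip_norm).
have fy : f = y.
  pose h := f - y.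
  have Mh : M h.
    by apply: subspaceB => //; apply: (sa_closed saT); apply: closure_subset Ky.
  have [Dh Th] : dom T h /\ T h = conjc z *: h.
    apply: (sa_adj saT) => //; first exact: subspaceZ.
    move=> x Dx; have := ly (T x - z *: x) (ex_intro2 _ _ x Dx erefl).
    rewrite ipZr conjcK -ipZl => e; apply/eqP; rewrite -subr_eq0 -ipBl /h.
    by rewrite ipBr e subrr.
  have := bc' h Dh; rewrite Th subrr nrm0 pmulr_rle0 // => nh.
  apply/eqP; rewrite -subr_eq0; apply/eqP/nrm_eq0/eqP.
  by rewrite eq_le nh nrm_ge0.
have ex_x (n : nat) : exists x, dom T x /\ nrm (y - (T x - z *: x)) < n.+1%:R^-1.
  have [|_ [x Dx <-] yx] := (closure_nrmP K y).1 Ky n.+1%:R^-1.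
    by rewrite invr_gt0.
  by exists x.
have [x hx] := choice ex_x.
have [|u hu] := @cauchy_nrm _ _ x.
  move=> e e0; have [|N hN] := @inv_succ_lt R (c * e / 2); first by rewrite !divr_gt0 ?mulr_gt0.
  exists N => m n /hN Nm /hN Nn.
  have [Dm hm] := hx m; have [Dn hn] := hx n.
  rewrite -(ltr_pM2l c0); apply: le_lt_trans (bc _ (subspaceB hD Dm Dn)) _.
  rewrite (linear_onB hD hT) // scalerBr.
  have -> : T (x m) - T (x n) - (z *: x m - z *: x n) =
      y - (T (x n) - z *: x n) - (y - (T (x m) - z *: x m)).
    move: (x m) (x n) (T (x m)) (T (x n)) => a' b' a b.
    by lincomb a b a' b' y; ring.
  apply: le_lt_trans (nrmB _ _) _.
  by have := lt_trans hm Nm; have := lt_trans hn Nn; lra.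
exists u; rewrite fy; suff [Du Tu] : dom T u /\ T u = y + z *: u.
  by split=> //; rewrite Tu addrK.
apply: sa_closed_graph => e e0.
pose e' := e / (1 + nrm z).
have z0 := nrm_ge0 z; have e'0 : 0 < e' by rewrite divr_gt0 // ltr_pwDl.
have [|N1 h1] := hu (e' / 2); first by rewrite divr_gt0.
have [|N2 h2] := @inv_succ_lt R (e' / 2); first by rewrite divr_gt0.
pose n := maxn N1 N2; have [Dn hn] := hx n.
have un := h1 n (leq_maxl _ _); have yn := lt_trans hn (h2 n (leq_maxr _ _)).
have ee : e = e' + nrm z * e' by rewrite /e'; field; rewrite gt_eqF // ltr_pwDl.
exists (x n); split=> //; first by nra.
have -> : y + z *: u - T (x n) = (y - (T (x n) - z *: x n)) + z *: (u - x n).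
  by move: (x n) (T (x n)) => b a; lincomb a b y u; ring.
apply: le_lt_trans (nrmD _ _) _; rewrite nrmZ.
nra.
Qed.

End Fixed.
End SelfAdjoint.

(** * Resolvents and spectral gaps *)

Section Resolvents.
Variables (R : realType) (H : completeNormedModType R[i]).
Variable ip : {dot H for Num.conj}.
Hypothesis ip_norm : norm_of_inner ip.
Variables (M : set H) (T : operator H).
Hypothesis saT : selfadjoint_in ip M T.
Let hD := (sa_lin saT).1.
Let hT := (sa_lin saT).2.
Let hM := sa_sub saT.

Lemma nonreal_regular (z : R[i]) : complex.Im z != 0 -> regular T z.
Proof.
move=> z0; exists `|complex.Im z|; first by rewrite normr_gt0.
exact: (nonreal_bounded_below ip_norm saT).
Qed.

Lemma regular_inj (z : R[i]) x y : regular T z -> dom T x -> dom T y ->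
  T x - z *: x = T y - z *: y -> x = y.
Proof.
move=> [c c0 bc] Dx Dy xy; have := bc _ (subspaceB hD Dx Dy).
rewrite (linear_onB hD hT) //.
have -> : T x - T y - z *: (x - y) = T x - z *: x - (T y - z *: y).
  by move: (T x) (T y) => u w; lincomb x y u w; ring.
rewrite xy subrr nrm0 pmulr_rle0 // => h; apply/eqP; rewrite -subr_eq0.
by apply/eqP/nrm_eq0/eqP; rewrite eq_le h nrm_ge0.
Qed.

Lemma resolvent_unique (z : R[i]) x f : regular T z -> dom T x ->
  T x - z *: x = f -> resolvent T z f = x.
Proof.
move=> rz Dx xf.
have [Dr rf] : [set x | dom T x /\ T x - z *: x = f] (resolvent T z f).
  by apply: (@xgetPex _ 0); exists x.
by apply: regular_inj rz Dr Dx _; rewrite rf.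
Qed.

Section Nonreal.
Variable z : R[i].
Hypothesis z0 : complex.Im z != 0.

Lemma Im_conj_neq0 : complex.Im (conjc z) != 0.
Proof. by case: z z0 => a b /=; rewrite oppr_eq0. Qed.

Lemma resolventP f : M f -> dom T (resolvent T z f) /\
  T (resolvent T z f) - z *: resolvent T z f = f.
Proof.
move=> Mf; have [x Tx] := regular_surj ip_norm saT (nonreal_regular z0)
  (nonreal_regular Im_conj_neq0) Mf.
by apply: (@xgetPex _ 0 [set x | dom T x /\ T x - z *: x = f]); exists x.
Qed.

Lemma resolvent_M f : M f -> M (resolvent T z f).
Proof. by move=> /resolventP[/(sa_dom saT)]. Qed.

Lemma resolventE f : M f -> T (resolvent T z f) = f + z *: resolvent T z f.
Proof. by move=> /resolventP[_ h]; rewrite -[X in _ = X + _]h subrK. Qed.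

Lemma resolvent_bound f : M f ->
  nrm (resolvent T z f) <= `|complex.Im z|^-1 * nrm f.
Proof.
move=> /resolventP[Dr rf].
rewrite ler_pdivlMl ?normr_gt0 // -[X in _ <= nrm X]rf.
exact: (nonreal_bounded_below ip_norm saT).
Qed.

Lemma resolvent_linear : linear_on M (resolvent T z).
Proof.
move=> a x y Mx My; have [Dx _] := resolventP Mx; have [Dy _] := resolventP My.
apply: resolvent_unique; first exact: nonreal_regular.
  exact: hD.2.
rewrite hT // !resolventE //.
move: (resolvent T z x) (resolvent T z y) => u w.
by lincomb x y u w; ring.
Qed.

Lemma resolvent_solution (t : R[i]) u h : dom T u -> T u - t *: u = h ->
  T (resolvent T z u) - t *: resolvent T z u = resolvent T z h.
Proof.
move=> Du uh; have Mu := sa_dom saT Du; have [Dr _] := resolventP Mu.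
apply/esym/resolvent_unique; first exact: nonreal_regular.
  rewrite resolventE //; apply: subspaceB => //; last exact: subspaceZ.
  by apply: subspaceD => //; exact: subspaceZ.
have Dzr := subspaceZ z hD Dr; have Dtr := subspaceZ t hD Dr.
have Dus := subspaceD hD Du Dzr.
rewrite resolventE // (linear_onB hD hT) // (linear_onD hT) //.
rewrite !(linear_onZ hD hT) // resolventE // -uh.
move: (resolvent T z u) (T u) => w v.
by lincomb u v w; ring.
Qed.

End Nonreal.

Lemma resolvent_identity (z w : R[i]) f : complex.Im z != 0 ->
  complex.Im w != 0 -> M f -> resolvent T z f - resolvent T w f =
  (z - w) *: resolvent T w (resolvent T z f).
Proof.
move=> z0 w0 Mf; have Mr := resolvent_M z0 Mf; have [Dr _] := resolventP z0 Mf.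
have E : resolvent T w ((z - w) *: resolvent T z f + f) = resolvent T z f.
  apply: resolvent_unique => //; first exact: nonreal_regular.
  by rewrite resolventE // -addrA -scalerBl addrC.
by rewrite -[X in X - _]E (resolvent_linear w0) // addrK.
Qed.

Lemma resolvent_adj (z : R[i]) f g : complex.Im z != 0 -> M f -> M g ->
  ip (resolvent T z f) g = ip f (resolvent T (conjc z) g).
Proof.
move=> z0 Mf Mg.
have [Df Ef] := resolventP z0 Mf; have [Dg Eg] := resolventP (Im_conj_neq0 z0) Mg.
rewrite -[X in ip _ X = _]Eg -[X in _ = ip X _]Ef ipBr ipBl ipZl ipZr conjcK.
by rewrite (sa_sym saT).
Qed.

End Resolvents.

Section Gaps.
Variables (R : realType) (H : completeNormedModType R[i]).
Variable ip : {dot H for Num.conj}.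
Hypothesis ip_norm : norm_of_inner ip.
Variables (M : set H) (T : operator H).
Hypothesis saT : selfadjoint_in ip M T.
Let hD := (sa_lin saT).1.
Let hT := (sa_lin saT).2.
Let hM := sa_sub saT.

(** [bounded_solutions_gap] rescaled from (-1, 1) to [(x - d, x + d)]. *)
Lemma bounded_solutions_bounded_below (x d b : R) v : 0 < d -> dom T v ->
  (forall t : R, `|t - x| < d ->
    exists u, [/\ dom T u, T u - t%:C *: u = v & nrm u <= b]) ->
  d * nrm v <= nrm (T v - x%:C *: v).
Proof.
move=> d0 Dv hb.
have dC : d%:C != 0 :> R[i] by rewrite fmorph_eq0 gt_eqF.
pose S := Operator (dom T) (fun y => d^-1%:C *: (T y - x%:C *: y)).
have SE y : S y = d^-1%:C *: (T y - x%:C *: y) by [].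
have lS : linear_operator S.
  split=> // a y1 y2 D1 D2; rewrite !SE hT //.
  move: (T y1) (T y2) => w1 w2; lincomb y1 y2 w1 w2; ring.
have sS : symmetric_op ip S.
  move=> y1 y2 D1 D2; rewrite !SE ripZl ripZr !(ripBl, ripBr, ripZl, ripZr).
  by rewrite (sa_symmetric_op saT).
have h : nrm v <= nrm (S v).
  apply: (@bounded_solutions_gap _ _ _ ip_norm _ _ (d * b)) => // s s1 s2.
  have [|u [Du Eu ub]] := hb (x + d * s).
    by rewrite addrC addKr normrM (gtr0_norm d0) gtr_pMr // ltr_norml s1.
  exists (d%:C *: u); split; first exact: subspaceZ.
    rewrite SE (linear_onZ hD hT) // -Eu rmorphD rmorphM fmorphV.
    by move: (T u) => w; lincomb u w w; field.
  by rewrite nrmZr gtr0_norm // ler_pM2l.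
move: h; rewrite SE nrmZr gtr0_norm ?invr_gt0 //.
by rewrite ler_pdivlMl.
Qed.

Lemma bounded_below_le (z : R[i]) (c c' : R) :
  c' <= c -> bounded_below T z c -> bounded_below T z c'.
Proof. by move=> cc h x Dx; apply: le_trans (h x Dx); rewrite ler_wpM2r // nrm_ge0. Qed.

Lemma uniform_bounded_below (a b : R) :
  (forall t : R, a <= t <= b -> regular T t%:C) ->
  exists2 c : R, 0 < c & forall t : R, a <= t <= b -> bounded_below T t%:C c.
Proof.
move=> reg.
have := (@compact_near_coveringP _ `[a, b]%classic).1 (@segment_compact _ a b).
move=> /(_ R (0^'+) (fun c t => bounded_below T t%:C c) _)[].
  move=> t /=; rewrite in_itv /= => /reg[c c0 bc].
  (* A bound [c] at [t] leaves [c - |t' - t|] at [t']. *)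
  exists ([set t' : R | `|t - t'| < c / 2], [set i : R | i < c / 2]); last first.
    move=> [t' i] /= [tt' ic] ; have := bounded_below_shift t'%:C bc.
    apply: bounded_below_le.
    by rewrite -rmorphB nrm_real distrC; lra.
  split=> /=; first by apply/nbhs_normP; exists (c / 2); rewrite //= divr_gt0.
  by apply: nbhs_right_lt; rewrite divr_gt0.
move=> e /= e0 he; exists (e / 2); first by rewrite divr_gt0.
move=> t tab; apply: he; rewrite /= ?in_itv //= ?divr_gt0 //.
by rewrite sub0r normrN gtr0_norm ?divr_gt0 //; lra.
Qed.

(** The norm of the resolvent at a real [x] is at most the inverse of the
    distance from [x] to the spectrum: the solutions of [(T - t) u = v] are
    uniformly bounded for [t] within [d] of [x], so [T] has a gap there. *)
Lemma regular_interval_bounded_below (x d : R) : 0 < d ->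
  (forall t : R, `|t - x| <= d -> regular T t%:C) -> bounded_below T x%:C d.
Proof.
move=> d0 reg.
have [t|c c0 bc] := @uniform_bounded_below (x - d) (x + d).
  by rewrite -ler_distl; exact: reg.
move=> v Dv.
apply: (@bounded_solutions_bounded_below _ _ (c^-1 * nrm v)) => // t td.
have rt := reg t (ltW td); have rt' := rt; rewrite -conjc_real in rt'.
have [u [Du Eu]] := regular_surj ip_norm saT rt rt' (sa_dom saT Dv).
exists u; split=> //; rewrite ler_pdivlMl // -[X in _ <= nrm X]Eu.
by apply: bc => //; rewrite -ler_distl ltW.
Qed.

End Gaps.

(** * Functionals bounded by the operator at every point of an interval *)

Section CyclicVector.
Variables (R : realType) (H : completeNormedModType R[i]).
Variable ip : {dot H for Num.conj}.
Hypothesis ip_norm : norm_of_inner ip.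
Variables (M : set H) (T : operator H).
Hypothesis saT : selfadjoint_in ip M T.
Let hD := (sa_lin saT).1.
Let hT := (sa_lin saT).2.
Let hM := sa_sub saT.
Variables (phi : H -> R[i]) (g : H).
Hypothesis Mg : M g.
Hypothesis phiE : forall v, dom T v -> phi v = ip (T v + 'i%C *: v) g.

Lemma Im_i_neq0 : complex.Im ('i%C : R[i]) != 0.
Proof. exact: oner_neq0. Qed.

Lemma phi_linear : linear_on (W := R[i]^o) (dom T) phi.
Proof.
move=> a x y Dx Dy; rewrite !phiE //; last exact: hD.2.
transitivity (ip (a *: (T x + 'i%C *: x) + (T y + 'i%C *: y)) g).
  2: by rewrite ipDl ipZl.
rewrite hT //; congr (ip _ _).
move: (T x) (T y) => u w; lincomb x y u w; ring.
Qed.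

(** Such [h] satisfy the hypothesis of the gap lemma around [x], but the bound
    [b] depends on [h]; the gap that they yield does not. *)
Definition solvable_around (x r : R) (h : H) :=
  exists b : R, forall t : R, `|t - x| < r ->
    exists u, [/\ dom T u, T u - t%:C *: u = h & nrm u <= b].

Lemma solvable_subspace (x r : R) : is_subspace (solvable_around x r).
Proof.
split.
  exists 0 => t _; exists 0; rewrite (linear_on0 hD hT) scaler0 subr0 nrm0.
  by split=> //; exact: hD.1.
move=> a h k [b hb] [c hc]; exists (nrm a * b + c) => t tx.
have [u [Du <- ub]] := hb t tx; have [w [Dw <- wc]] := hc t tx.
exists (a *: u + w); split; first exact: hD.2.
  rewrite hT //; move: (T u) (T w) => u' w'; lincomb u w u' w'; ring.
apply: le_trans (nrmD _ _) _; rewrite nrmZ lerD // ler_wpM2l //.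
exact: nrm_ge0.
Qed.

Lemma solvable_resolvent (x r : R) z h : complex.Im z != 0 ->
  solvable_around x r h -> solvable_around x r (resolvent T z h).
Proof.
move=> z0 [b hb]; exists (`|complex.Im z|^-1 * b) => t tx.
have [u [Du uh ub]] := hb t tx; have Mu := sa_dom saT Du.
exists (resolvent T z u); split.
- exact: (resolventP ip_norm saT z0 Mu).1.
- exact: (resolvent_solution ip_norm saT z0 Du uh).
- apply: le_trans (resolvent_bound ip_norm saT z0 Mu) _.
  by rewrite ler_wpM2l // invr_ge0 normr_ge0.
Qed.

Definition phi_bounded_at (t N : R) :=
  forall v, dom T v -> nrm (phi v) <= N * nrm (T v - t%:C *: v).

(** The vector [y] is [(T - t)^-1 phi] in the generalized sense. It represents
    the functional that sends [(T - t) v] to [phi v]. *)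
Lemma phi_riesz (t N : R) : 0 <= N -> phi_bounded_at t N ->
  exists y, [/\ M y, nrm y <= N &
    forall v, dom T v -> phi v = ip (T v - t%:C *: v) y].
Proof.
move=> N0 bN; pose K := [set T v - t%:C *: v | v in dom T].
pose l k := phi (xget 0 [set v | dom T v /\ T v - t%:C *: v = k]).
have lE v : dom T v -> l (T v - t%:C *: v) = phi v.
  move=> Dv; rewrite /l; set w := xget _ _.
  have [Dw Tw] : [set w | dom T w /\ T w - t%:C *: w = T v - t%:C *: v] w.
    by apply: (@xgetPex _ 0); exists v.
  have Dwv := subspaceB hD Dw Dv.
  apply/eqP; rewrite -subr_eq0 -(linear_onB hD phi_linear) //; apply/eqP/nrm_eq0/eqP.
  rewrite eq_le nrm_ge0 andbT; apply: le_trans (bN _ Dwv) _.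
  rewrite (linear_onB hD hT) //.
  have -> : T w - T v - t%:C *: (w - v) = T w - t%:C *: w - (T v - t%:C *: v).
    by move: (T w) (T v) => a b; lincomb a b w v; ring.
  by rewrite Tw subrr nrm0 mulr0.
have hK : is_subspace K.
  split; first by exists 0; [exact: hD.1 | rewrite (linear_on0 hD hT) scaler0 subr0].
  move=> a _ _ [x Dx <-] [y Dy <-]; exists (a *: x + y); first exact: hD.2.
  by rewrite hT //; move: (T x) (T y) => u w; lincomb x y u w; ring.
have [|_ [v Dv <-]|y [Ky ly yN]] := riesz ip_norm (l := l) hK _ N0.
- move=> a _ _ [x Dx <-] [y Dy <-]; rewrite !lE // -phi_linear // -lE; last exact: hD.2.
  rewrite hT //; congr l.
  by move: (T x) (T y) => u w; lincomb x y u w; ring.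
- by rewrite lE //; exact: bN.
- exists y; split=> //.
    apply: (sa_closed saT); apply: closure_subset Ky => _ [x Dx <-].
    apply: subspaceB => //; first exact: (sa_ran saT).
    by apply: subspaceZ => //; exact: (sa_dom saT).
  by move=> v Dv; rewrite -lE // ly //; exists v.
Qed.

(** With [y = (T - t)^-1 phi], the vector [(T - z)^-1 (T - i)^-1 y] solves
    [(T - t) u = (T - z)^-1 g], because [g = (T - i)^-1 phi]. *)
Lemma solvable_generator (x r N : R) z : 0 <= N -> complex.Im z != 0 ->
  (forall t, `|t - x| < r -> phi_bounded_at t N) ->
  solvable_around x r (resolvent T z g).
Proof.
move=> N0 z0 bN; exists (`|complex.Im z|^-1 * N) => t tx.
have [y [My yN yE]] := phi_riesz N0 (bN t tx).
have i0 := Im_i_neq0; have zc0 := Im_conj_neq0 z0; have ic0 := Im_conj_neq0 i0.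
have MRy := resolvent_M ip_norm saT i0 My.
have [Du Eu] := resolventP ip_norm saT z0 MRy.
have [Dg Eg] := resolventP ip_norm saT z0 Mg.
exists (resolvent T z (resolvent T 'i%C y)); split => //; last first.
  apply: le_trans (resolvent_bound ip_norm saT z0 MRy) _.
  rewrite ler_wpM2l ?invr_ge0 ?normr_ge0 //.
  apply: le_trans (resolvent_bound ip_norm saT i0 My) _.
  by rewrite /= normr1 invr1 mul1r.
set u := resolvent T z _ in Du Eu *; apply/eqP; rewrite -subr_eq0; apply/eqP.
have Mu := sa_dom saT Du.
apply: (orth_closure0 ip_norm (S := dom T)).
  apply: (sa_dense saT); apply: subspaceB => //; last exact: (sa_dom saT).
  by apply: subspaceB => //; [exact: (sa_ran saT) | exact: subspaceZ].
move=> e De; have Me := sa_dom saT De.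
have Mr := resolvent_M ip_norm saT zc0 Me.
have [Dr _] := resolventP ip_norm saT zc0 Me.
pose q := resolvent T (conjc 'i%C) (resolvent T (conjc z) e).
have [Dq _] := resolventP ip_norm saT ic0 Mr.
have MTe : M (T e - t%:C *: e).
  by apply: subspaceB => //; [exact: (sa_ran saT) | exact: subspaceZ].
have qE : T q - t%:C *: q =
    resolvent T (conjc 'i%C) (resolvent T (conjc z) (T e - t%:C *: e)).
  by do 2!(apply: (resolvent_solution ip_norm saT) => //).
have MRT := resolvent_M ip_norm saT zc0 MTe.
have -> : ip e (T u - t%:C *: u - resolvent T z g) =
    ip (T e - t%:C *: e) u - ip e (resolvent T z g).
  by rewrite !ipBr ipBl (sa_sym saT) // ipZl ipZr conjc_real.
have adj1 : ip (T e - t%:C *: e) u = ip (T q - t%:C *: q) y.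
  by rewrite qE !(resolvent_adj ip_norm saT) ?conjcK.
have adj2 : ip e (resolvent T z g) = ip (resolvent T (conjc z) e) g.
  by rewrite (resolvent_adj ip_norm saT) ?conjcK.
rewrite adj1 -yE // phiE // adj2 /q (resolventE ip_norm saT) //.
by rewrite -addrA -scalerDl conjc_i addNr scale0r addr0 subrr.
Qed.

Hypothesis cyclic_g :
  M `<=` closure (lspan [set resolvent T z g | z in [set z | complex.Im z != 0]]).

(** Cyclicity makes the solvable vectors dense. Applying [(T - i)^-1], which
    preserves solvability, makes them dense for the graph norm of [T], so that
    the gap inequality passes to the whole domain. *)
Lemma phi_bounded_regular (x r N : R) : 0 < r -> 0 <= N ->
  (forall t, `|t - x| < r -> phi_bounded_at t N) -> regular T x%:C.
Proof.
move=> r0 N0 bN; exists r => // v Dv.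
have i0 := Im_i_neq0.
pose f := T v - 'i%C *: v.
have Mf : M f.
  apply: subspaceB => //; first exact: (sa_ran saT).
  by apply: subspaceZ => //; exact: (sa_dom saT).
have vf : resolvent T 'i%C f = v.
  exact: (resolvent_unique saT (nonreal_regular ip_norm saT i0) Dv).
have spanS : lspan [set resolvent T z g | z in [set z | complex.Im z != 0]] `<=`
    solvable_around x r `&` M.
  apply: smallest_sub.
    split; first by split; [exact: (solvable_subspace x r).1 | exact: hM.1].
    move=> a h k [sh Mh] [sk Mk]; split; last exact: hM.2.
    exact: (solvable_subspace x r).2.
  move=> _ [z z0 <-]; split; first exact: (solvable_generator N0).
  exact: (resolvent_M ip_norm saT).
pose K := nrm ('i%C - x%:C); pose C := r + 1 + K.
have K0 : 0 <= K := nrm_ge0 _.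
apply: le_eps => e e0; have C0 : 0 < C by rewrite /C; lra.
have [|k /spanS[sk Mk] fk] := (closure_nrmP _ _).1 (cyclic_g Mf) (e / C).
  by rewrite divr_gt0.
pose h := resolvent T 'i%C k; have [Dh Eh] := resolventP ip_norm saT i0 Mk.
have [b hb] := solvable_resolvent i0 sk.
have gap := bounded_solutions_bounded_below ip_norm saT r0 Dh hb.
have vh : nrm (v - h) <= nrm (f - k).
  rewrite -vf /h -(linear_onB hM (resolvent_linear ip_norm saT i0)) //.
  apply: le_trans (resolvent_bound ip_norm saT i0 (subspaceB hM Mf Mk)) _.
  by rewrite /= normr1 invr1 mul1r.
have vE : T h - x%:C *: h = T v - x%:C *: v - ((f - k) + ('i%C - x%:C) *: (v - h)).
  by rewrite -Eh /f -/h; move: (T v) (T h) => a1 a2; lincomb v h a1 a2; ring.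
have : nrm (T h - x%:C *: h) <= nrm (T v - x%:C *: v) + (1 + K) * nrm (f - k).
  rewrite vE; apply: le_trans (nrmB _ _) _; rewrite lerD2l.
  apply: le_trans (nrmD _ _) _; rewrite nrmZ -/K mulrDl mul1r lerD2l.
  by rewrite ler_wpM2l.
have : nrm v <= nrm h + nrm (f - k).
  by rewrite -[X in nrm X <= _](subrK h) addrC; apply: le_trans (nrmD _ _) _; rewrite lerD2l.
have : C * nrm (f - k) <= e by rewrite mulrC -ler_pdivlMr // ltW.
move: gap; rewrite /C -/h; move: (nrm v) (nrm h) (nrm (f - k)) => a1 a2 a3 *.
nra.
Qed.

(** Between points of the spectrum the bound persists: a regular [t] near [x]
    has a spectral point [t1] within [2 d], where [d] is the best lower bound of
    [T - t], and replacing [T - t1] by [T - t] costs [2 d |v|], hence at most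
    [4 |(T - t) v|]. *)
Lemma phi_bounded_near_regular (x e N : R) : 0 <= N -> ~ regular T x%:C ->
  (forall t, `|t - x| < e -> ~ regular T t%:C -> phi_bounded_at t N) ->
  forall t, `|t - x| < e / 4 -> phi_bounded_at t (5 * N).
Proof.
move=> N0 nrx bN t tx.
have e0 : 0 < e by have := normr_ge0 (t - x); lra.
have [rt|nrt] := pselect (regular T t%:C); last first.
  move=> v Dv; have := bN t _ nrt v Dv; have := nrm_ge0 (T v - t%:C *: v).
  have te : `|t - x| < e by lra.
  by move=> ? /(_ te); nra.
have [c0 c00 bc0] := rt.
pose S := [set r : R | bounded_below T t%:C r].
have ubS r : S r -> r <= `|t - x|.
  move=> Sr; rewrite leNgt; apply/negP => rx; apply: nrx.
  exists (r - nrm (x%:C - t%:C)); last exact: bounded_below_shift.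
  by rewrite -rmorphB nrm_real distrC subr_gt0.
have hS : has_sup S by split; [exists c0 | exists `|t - x|].
pose d := sup S.
have d0 : 0 < d by apply: lt_le_trans c00 _; apply: ub_le_sup => //; case: hS.
have dx : d <= `|t - x| by apply: ge_sup => //; case: hS.
have [t1 [t1d nrt1]] : exists t1 : R, `|t1 - t| <= 2 * d /\ ~ regular T t1%:C.
  apply: contrapT => hno.
  have : S (2 * d).
    apply: (regular_interval_bounded_below ip_norm saT); first by lra.
    by move=> t1 t1d; apply: contrapT => nr; apply: hno; exists t1.
  move=> S2; have : 2 * d <= d by apply: ub_le_sup => //; case: hS.
  lra.
have d20 : 0 < d / 2 by rewrite divr_gt0.
have [r Sr rd] := sup_adherent d20 hS; rewrite -/d in rd.
have t1x : `|t1 - x| < e.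
  have := ler_normD (t1 - t) (t - x); rewrite addrA subrK; lra.
move=> v Dv; have h1 := bN t1 t1x nrt1 v Dv; have h2 := Sr v Dv.
have h3 : nrm (T v - t1%:C *: v) <= nrm (T v - t%:C *: v) + `|t1 - t| * nrm v.
  have -> : T v - t1%:C *: v = T v - t%:C *: v - (t1 - t)%:C *: v.
    by rewrite rmorphB scalerBl opprB addrA subrK.
  by apply: le_trans (nrmB _ _) _; rewrite nrmZr.
have v0 := nrm_ge0 v.
have h4 : nrm (T v - t1%:C *: v) <= 5 * nrm (T v - t%:C *: v) by nra.
by apply: le_trans h1 _; rewrite -mulrA mulrCA ler_wpM2l.
Qed.

Lemma phi_unbounded_near (x e N : R) : 0 < e -> 0 <= N -> ~ regular T x%:C ->
  exists t, [/\ `|t - x| < e, ~ regular T t%:C & ~ phi_bounded_at t N].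
Proof.
move=> e0 N0 nrx; apply: contrapT => hno; apply: (nrx).
apply: (@phi_bounded_regular x (e / 4) (5 * N)); first by rewrite divr_gt0.
  by rewrite mulr_ge0.
apply: phi_bounded_near_regular => // t tx nrt; apply: contrapT => nb.
by apply: hno; exists t.
Qed.

End CyclicVector.

(** * The part of a self-adjoint operator in a cyclic space *)

Section CyclicSubspace.
Variables (R : realType) (H : completeNormedModType R[i]).
Variable ip : {dot H for Num.conj}.
Hypothesis ip_norm : norm_of_inner ip.
Variable A : operator H.
Hypothesis A_sa : self_adjoint ip A.

Lemma lspan_subspace (S : set H) : is_subspace (lspan S).
Proof.
split; first by move=> D [[D0 _] _].
by move=> a x y hx hy D [hD SD]; apply: hD.2; [exact: hx | exact: hy].
Qed.

Lemma closure_subspace (D : set H) : is_subspace D -> is_subspace (closure D).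
Proof.
move=> hD; split; first by apply: subset_closure; exact: hD.1.
move=> a x y /closure_nrmP cx /closure_nrmP cy; apply/closure_nrmP => e e0.
have a0 := nrm_ge0 a; have a1 : 0 < nrm a + 1 by lra.
have [|x' Dx xx] := cx (e / (nrm a + 1)); first by rewrite divr_gt0.
have [|y' Dy yy] := cy (e / (nrm a + 1)); first by rewrite divr_gt0.
exists (a *: x' + y'); first exact: hD.2.
have -> : a *: x + y - (a *: x' + y') = a *: (x - x') + (y - y').
  by rewrite scalerBr opprD addrACA.
apply: le_lt_trans (nrmD _ _) _; rewrite nrmZ.
have -> : e = nrm a * (e / (nrm a + 1)) + e / (nrm a + 1).
  by field; rewrite gt_eqF.
by apply: ler_ltD => //; rewrite ler_wpM2l // ltW.
Qed.

Lemma self_adjoint_in_setT : selfadjoint_in ip setT A.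
Proof.
have [lA dA [dE aE]] := A_sa.
have dense_dom x : closure (dom A) x.
  by apply/closure_nrmP => e e0; exact: dense_nrmP.
have sym x y : dom A x -> dom A y -> ip (A x) y = ip x (A y).
  move=> Dx Dy; have : dom (adjoint ip A) y by rewrite dE.
  move=> /(@xgetPex _ 0) /(_ x Dx); rewrite /inner => ->.
  by rewrite -(aE y Dy).
split=> //.
move=> y w _ _ yw.
have Dy : dom A y by rewrite -dE; exists w => x Dx; exact: yw.
split=> //; apply/eqP; rewrite -subr_eq0; apply/eqP.
apply: (orth_closure0 ip_norm (dense_dom _)) => x Dx.
by rewrite ipBr -sym // yw // subrr.
Qed.

Let saA := self_adjoint_in_setT.

Lemma nonrealE (z : R[i]) : (z \isn't Num.real) = (complex.Im z != 0).
Proof. by case: z => a b; rewrite complex_real. Qed.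

Variable g : H.
Let M := cyclic_space A g.

Lemma cyclic_subspace : is_subspace M.
Proof. exact: closure_subspace (lspan_subspace _). Qed.

Lemma cyclic_closed : closure M `<=` M.
Proof. by rewrite /M /cyclic_space -((closure_id _).1 (@closed_closure _ _)). Qed.

Lemma cyclic_generator z : complex.Im z != 0 -> M (resolvent A z g).
Proof.
move=> z0; apply: subset_closure => D [_]; apply.
by exists z => //; rewrite /mkset nonrealE.
Qed.

Lemma cyclic_ind (P : set H) : is_subspace P -> closure P `<=` P ->
  (forall z, complex.Im z != 0 -> P (resolvent A z g)) -> M `<=` P.
Proof.
move=> hP cP gP; apply: subset_trans cP; apply: closure_subset.
apply: smallest_sub => // _ [z z0 <-]; apply: gP.
by rewrite -nonrealE.
Qed.

(** On a generator this is the resolvent identity, which needs two different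
    parameters; if they coincide, one is perturbed. *)
Lemma cyclic_resolvent z f : complex.Im z != 0 -> M f -> M (resolvent A z f).
Proof.
move=> z0; have lin := resolvent_linear ip_norm saA z0.
have i0 : 0 < `|complex.Im z|^-1 by rewrite invr_gt0 normr_gt0.
have cont (x y : H) e : nrm (x - y) < e ->
    nrm (resolvent A z x - resolvent A z y) < `|complex.Im z|^-1 * e.
  move=> xy; rewrite -(linear_onB (sa_sub saA) lin) //.
  apply: le_lt_trans (resolvent_bound ip_norm saA z0 _) _ => //.
  by rewrite ltr_pM2l.
apply: (@cyclic_ind [set f | M (resolvent A z f)]).
- split; first by rewrite /mkset (linear_on0 (sa_sub saA) lin); exact: cyclic_subspace.1.
  by move=> a x y Mx My; rewrite /mkset lin //; exact: cyclic_subspace.2.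
- move=> x /closure_nrmP cx; apply: cyclic_closed; apply/closure_nrmP => e e0.
  have [|y My xy] := cx (`|complex.Im z| * e).
    by rewrite mulr_gt0 // normr_gt0.
  exists (resolvent A z y) => //; have := cont _ _ _ xy.
  by rewrite mulrA mulVf ?mul1r // normr_eq0.
move=> w w0; rewrite /mkset; apply: cyclic_closed; apply/closure_nrmP => e e0.
pose a := `|complex.Im w|^-1; have a0 : 0 < a by rewrite invr_gt0 normr_gt0.
pose K := `|complex.Im z|^-1 * (a * (a * nrm g)).
have K0 : 0 <= K by rewrite !mulr_ge0 ?nrm_ge0 // ltW.
have [d [d0 dK dz]] : exists d : R, [/\ 0 < d, d * K < e & w + d%:C != z].
  pose d := e / (K + 1).
  have d0 : 0 < d by rewrite divr_gt0 //; lra.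
  have dK : d * K < e by rewrite /d mulrAC ltr_pdivrMr; [nra | lra].
  have [dz|dz] := eqVneq (w + d%:C) z; last by exists d.
  exists (d / 2); split; [by rewrite divr_gt0 | nra |].
  rewrite -dz; apply/negP => /eqP/addrI/complexI; lra.
have w'0 : complex.Im (w + d%:C) != 0.
  by case: (w) w0 => p q /=; rewrite addr0.
exists (resolvent A z (resolvent A (w + d%:C) g)).
  have -> : resolvent A z (resolvent A (w + d%:C) g) =
     (w + d%:C - z)^-1 *: (resolvent A (w + d%:C) g - resolvent A z g).
    rewrite (resolvent_identity ip_norm saA w'0 z0) // scalerA mulVf ?scale1r //.
    by rewrite subr_eq0.
  apply: subspaceZ cyclic_subspace _; apply: subspaceB cyclic_subspace _ _;
  exact: cyclic_generator.
apply: le_lt_trans dK; rewrite -(linear_onB (sa_sub saA) lin) //.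
apply: le_trans (resolvent_bound ip_norm saA z0 _) _ => //.
rewrite /K mulrCA ler_pM2l //.
rewrite nrm_sub (resolvent_identity ip_norm saA w'0 w0) //.
rewrite addrC addKr nrmZr gtr0_norm // ler_pM2l //.
apply: le_trans (resolvent_bound ip_norm saA w0 _) _ => //.
rewrite ler_pM2l //.
apply: le_trans (resolvent_bound ip_norm saA w'0 _) _ => //.
by rewrite /a; case: (w) => p q /=; rewrite addr0.
Qed.

(** The part of [(A - z) x] orthogonal to [M] is mapped by [(A - z)^-1] both into
    [M] and into its orthogonal complement. *)
Lemma cyclic_range x z : complex.Im z != 0 -> dom A x -> M x ->
  M (A x - z *: x).
Proof.
move=> z0 Dx Mx; set h := A x - z *: x.
have Rh : resolvent A z h = x.
  exact: (resolvent_unique saA (nonreal_regular ip_norm saA z0) Dx).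
have [|k _|p [Mp hp _]] := riesz ip_norm (l := fun k => ip k h) cyclic_subspace _ (nrm_ge0 h).
- by move=> a u v _ _; rewrite ipDl ipZl.
- by rewrite mulrC (ip_CS ip_norm).
have {}Mp := cyclic_closed Mp.
have zc0 := Im_conj_neq0 z0.
have [Dr Er] := resolventP ip_norm saA z0 (I : setT (h - p)).
have r0 : resolvent A z (h - p) = 0.
  apply: (orth_closure0 ip_norm (S := M)).
    apply: subset_closure.
    rewrite (linear_onB (sa_sub saA) (resolvent_linear ip_norm saA z0)) // Rh.
    by apply: subspaceB cyclic_subspace _ _ => //; exact: cyclic_resolvent.
  move=> m Mm; have := resolvent_adj ip_norm saA zc0 (I : setT m) (I : setT (h - p)).
  rewrite conjcK => <-; rewrite ipBr hp ?subrr //.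
  exact: cyclic_resolvent.
have : h - p = 0.
  by rewrite -Er r0 (linear_on0 (sa_lin saA).1 (sa_lin saA).2) scaler0 subrr.
by move/eqP; rewrite subr_eq0 => /eqP ->.
Qed.

Lemma cyclic_vector_in : M g.
Proof.
have i0 := Im_i_neq0 R; have [Dr Er] := resolventP ip_norm saA i0 (I : setT g).
by rewrite -Er; apply: cyclic_range => //; exact: cyclic_generator.
Qed.

Lemma cyclic_selfadjoint_in : selfadjoint_in ip M (op_restrict A M).
Proof.
have hM := cyclic_subspace; have [hD hA] := sa_lin saA.
have i0 := Im_i_neq0 R; have ic0 := Im_conj_neq0 i0.
split=> //.
- exact: cyclic_closed.
- split; last by move=> a x y [Dx _] [Dy _] /=; exact: hA.
  split; first by split; [exact: hD.1 | exact: hM.1].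
  by move=> a x y [Dx Mx] [Dy My]; split; [exact: hD.2 | exact: hM.2].
- by move=> x [].
- move=> x [Dx Mx] /=; rewrite -[A x](subrK ('i%C *: x)).
  by apply: (subspaceD hM); [exact: (cyclic_range i0) | exact: (subspaceZ _ hM)].
- apply: closure_subset; apply: smallest_sub.
    split; first by split; [exact: hD.1 | exact: hM.1].
    by move=> a x y [Dx Mx] [Dy My]; split; [exact: hD.2 | exact: hM.2].
  move=> _ [z z0 <-]; rewrite /mkset nonrealE in z0; split.
    exact: (resolventP ip_norm saA z0 (I : setT g)).1.
  exact: cyclic_generator.
- by move=> x y [Dx _] [Dy _] /=; exact: (sa_sym saA).
have ii : 'i%C + conjc 'i%C = 0 :> R[i] by rewrite conjc_i subrr.
(* Testing against the vectors [(A - i)^-1 m] suffices, since they lie in [M]. *)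
move=> y w My Mw yw /=.
pose f := w + 'i%C *: y.
have Mf : M f by apply: (subspaceD hM) => //; exact: (subspaceZ _ hM).
have [Df Ef] := resolventP ip_norm saA ic0 (I : setT f).
have yE : y = resolvent A (conjc 'i%C) f.
  apply/eqP; rewrite -subr_eq0; apply/eqP.
  apply: (orth_closure0 ip_norm (S := M)).
    by apply: subset_closure; apply: (subspaceB hM) => //; exact: cyclic_resolvent.
  move=> m Mm; have [Dm Em] := resolventP ip_norm saA i0 (I : setT m).
  have := yw _ (conj Dm (cyclic_resolvent i0 Mm)).
  rewrite [app _ _](resolventE ip_norm saA i0) // ipDl ipZl => e.
  rewrite ipBr -(resolvent_adj ip_norm saA) // /f ipDr -e ipZr.
  by rewrite -addrA -mulrDl ii mul0r addr0 subrr.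
split; first by split=> //; rewrite yE.
rewrite {1}yE (resolventE ip_norm saA ic0) // -yE /f.
by rewrite -addrA -scalerDl ii scale0r addr0.
Qed.

End CyclicSubspace.

(** * The exceptional set *)

(** The point [y] is common to nested intervals centred in [K], each of them
    contained in the corresponding [U n]; it may lie outside [K]. *)
Lemma baire_on_subset (R : realType) (K : set R) (U : nat -> set R) :
  (forall n x, U n x -> exists2 d : R, 0 < d & forall y, `|y - x| < d -> U n y) ->
  (forall n x (e : R), K x -> 0 < e ->
    exists t, [/\ K t, `|t - x| < e & U n t]) ->
  forall x (e : R), K x -> 0 < e ->
    exists y, `|y - x| <= e /\ forall n, U n y.
Proof.
move=> oU dU x e Kx e0.
pose valid (p : R * R) := K p.1 /\ 0 < p.2.
pose good n (p q : R * R) := [/\ valid q, `|q.1 - p.1| + q.2 <= p.2 &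
  forall y, `|y - q.1| <= q.2 -> U n y].
have step (np : nat * (R * R)) : exists q, valid np.2 -> good np.1 np.2 q.
  case: np => n [y r]; have [[/= Ky r0]|nv] := pselect (valid (y, r)); last by exists (y, r).
  have r20 : 0 < r / 2 by rewrite divr_gt0.
  have [t [Kt ty Ut]] := dU n y (r / 2) Ky r20.
  have [d d0 dU'] := oU n t Ut.
  exists (t, Order.min (r / 2) (d / 2)) => _.
  have m0 : 0 < Order.min (r / 2) (d / 2) by rewrite lt_min r20 divr_gt0.
  have m1 : Order.min (r / 2) (d / 2) <= r / 2 by rewrite ge_min lexx.
  have m2 : Order.min (r / 2) (d / 2) <= d / 2 by rewrite ge_min lexx orbT.
  split=> //=; first by lra.
  by move=> z zt; apply: dU'; lra.
have [F hF] := choice step.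
pose s := fix s n := if n is m.+1 then F (m, s m) else (x, e).
have vs n : valid (s n).
  by elim: n => [//|n IH]; have [] := hF (n, s n) IH.
have gs n : good n (s n) (s n.+1) by exact: (hF (n, s n) (vs n)).
pose a n := (s n).1 - (s n).2; pose b n := (s n).1 + (s n).2.
have a_le n k : a n <= a (n + k)%N.
  elim: k => [|k IH]; first by rewrite addn0.
  apply: le_trans IH _; rewrite addnS /a.
  have [_ h _] := gs (n + k)%N; have := ler_norm ((s (n + k)%N).1 - (s (n + k).+1).1).
  rewrite distrC; lra.
have b_ge n k : b (n + k)%N <= b n.
  elim: k => [|k IH]; first by rewrite addn0.
  apply: le_trans IH; rewrite addnS /b.
  have [_ h _] := gs (n + k)%N; have := ler_norm ((s (n + k).+1).1 - (s (n + k)%N).1).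
  lra.
have ab n : a n <= b n by have [_] := vs n; rewrite /a /b; lra.
have a_b n m : a n <= b m.
  apply: le_trans (a_le n m) _; apply: le_trans (ab _) _.
  by rewrite addnC b_ge.
have hS : has_sup (range a).
  by split; [exists (a 0), 0%N | exists (b 0) => _ [n _ <-]].
pose y := sup (range a).
have ay n : a n <= y by apply: ub_le_sup; [case: hS | exists n].
have yb n : y <= b n by apply: ge_sup; [case: hS | move=> _ [m _ <-]].
have ys n : `|y - (s n).1| <= (s n).2.
  by rewrite ler_distl; have := ay n; have := yb n; rewrite /a /b => -> ->.
exists y; split; first exact: ys 0%N.
by move=> n; have [_ _] := gs n; apply; exact: ys.
Qed.

Section Perturbation.
Variables (R : realType) (H : completeNormedModType R[i]).
Variable ip : {dot H for Num.conj}.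
Hypothesis ip_norm : norm_of_inner ip.
Variable A : operator H.
Hypothesis A_sa : self_adjoint ip A.
Let saA := self_adjoint_in_setT ip_norm A_sa.
Let hD := (sa_lin saA).1.
Let hA := (sa_lin saA).2.

Lemma regular_resolvent_set (M : set H) (T : operator H) (z : R[i]) :
  selfadjoint_in ip M T -> regular T z -> regular T (conjc z) ->
  resolvent_set M T z.
Proof.
move=> saT rz rz'; split.
  split.
  - move=> x Dx; apply: (subspaceB (sa_sub saT)); first exact: (sa_ran saT).
    by apply: (subspaceZ _ (sa_sub saT)); exact: (sa_dom saT).
  - by move=> x y /set_mem Dx /set_mem Dy; exact: (regular_inj saT rz Dx Dy).
  - by move=> f /(regular_surj ip_norm saT rz rz')[x [Dx Ex]]; exists x.
have [c c0 bc] := rz; exists c^-1 => x /bc.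
by rewrite !normE -rmorphM lecR ler_pdivlMl.
Qed.

Lemma spectrum_real (M : set H) (T : operator H) (z : R[i]) :
  selfadjoint_in ip M T -> spectrum M T z ->
  z = (complex.Re z)%:C /\ ~ regular T (complex.Re z)%:C.
Proof.
move=> saT sz; have z0 : complex.Im z = 0.
  apply/eqP; apply: contraT => z0; case: sz; apply: (regular_resolvent_set saT).
    exact: (nonreal_regular ip_norm saT).
  by apply: (nonreal_regular ip_norm saT); exact: Im_conj_neq0.
have zE : z = (complex.Re z)%:C by case: (z) z0 => a b /= ->.
split=> // rz; apply: sz; rewrite zE.
by apply: (regular_resolvent_set saT) => //; rewrite conjc_real.
Qed.

Variables (phi : H -> R[i]) (g : H).
Hypothesis gP : forall eta : H,
  inner ip g eta = phi (resolvent A (conjc 'i%C) eta).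

Let i0 := Im_i_neq0 R.
Let ic0 := Im_conj_neq0 i0.

Lemma phi_repr v : dom A v -> phi v = ip (A v + 'i%C *: v) g.
Proof.
move=> Dv; have := gP (A v + 'i%C *: v); rewrite /inner => ->; congr phi.
apply/esym/(resolvent_unique saA) => //; first exact: (nonreal_regular ip_norm saA).
by rewrite conjc_i scaleNr opprK.
Qed.

Let phi_lin := phi_linear saA phi_repr.
Let M := cyclic_space A g.
Let T := op_restrict A M.
Let saT := cyclic_selfadjoint_in ip_norm A_sa g.

(** The points [z] at which [phi] is not bounded by [A - z] on the domain of the
    part of [A] in [M]. For a real [z] and the spectral measure [mu] of [phi],
    this says that the integral of [1 / (t - z)^2] against [mu] is infinite. *)
Definition unbounded_set : set R[i]^o := \bigcap_(n : nat)
  [set z | exists2 v, dom T v & n%:R * nrm (A v - z *: v) < nrm (phi v)].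

Lemma unbounded_stage_open (n : nat) : open ([set z : R[i]^o |
  exists2 v, dom T v & n%:R * nrm (A v - z *: v) < nrm (phi v)]).
Proof.
apply: open_nrmP => z [v Dv zv].
pose K := n%:R * nrm v + 1.
have n0 : 0 <= n%:R :> R by rewrite ler0n.
have K0 : 0 < K by have := nrm_ge0 v; rewrite /K; nra.
exists ((nrm (phi v) - n%:R * nrm (A v - z *: v)) / K).
  by rewrite divr_gt0 // subr_gt0.
move=> w; rewrite ltr_pdivlMr // => zw; exists v => //.
have : nrm (A v - w *: v) <= nrm (A v - z *: v) + nrm (z - w) * nrm v.
  have -> : A v - w *: v = A v - z *: v + (z - w) *: v.
    by rewrite scalerBl addrA subrK.
  by apply: le_trans (nrmD _ _) _; rewrite nrmZ.
move=> h; have := nrm_ge0 (z - w); have : n%:R * nrm (A v - w *: v) <=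
  n%:R * (nrm (A v - z *: v) + nrm (z - w) * nrm v) by rewrite ler_wpM2l.
move: zw; rewrite /K; lra.
Qed.

(** At a point of the resolvent set, [A - z] controls both [A v] and [v], hence
    [phi v = <g, (A + i) v>]. *)
Lemma unbounded_spectrum : unbounded_set `<=` spectrum M T.
Proof.
move=> z Gz [_ [C hC]].
pose K := nrm g * (1 + nrm (z + 'i%C) * `|C|).
have [v Dv] := Gz (Num.truncn K).+1 I; apply/negP; rewrite -leNgt.
have hC' : nrm v <= `|C| * nrm (A v - z *: v).
  have := hC v Dv; rewrite !normE -rmorphM lecR => /le_trans; apply.
  by rewrite ler_wpM2r ?nrm_ge0 // ler_norm.
have -> : phi v = ip (A v - z *: v + (z + 'i%C) *: v) g.
  by rewrite scalerDl addrA subrK phi_repr //; case: Dv.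
apply: le_trans (ip_CS ip_norm _ _) _.
apply: (@le_trans _ _ (K * nrm (A v - z *: v))); last first.
  by rewrite ler_wpM2r ?nrm_ge0 // ltW // truncnS_gt.
rewrite mulrC /K -mulrA ler_wpM2l ?nrm_ge0 // mulrDl mul1r.
apply: le_trans (nrmD _ _) _; rewrite lerD2l nrmZ -mulrA ler_wpM2l ?nrm_ge0 //.
Qed.

Lemma unbounded_dense : spectrum M T `<=` closure unbounded_set.
Proof.
move=> z sz; have [zE nr] := spectrum_real saT sz.
have phiT v : dom T v -> phi v = ip (T v + 'i%C *: v) g.
  by move=> [Dv _]; exact: phi_repr.
have cyc : M `<=` closure
    (lspan [set resolvent T w g | w in [set w | complex.Im w != 0]]).
  have -> : [set resolvent T w g | w in [set w | complex.Im w != 0]] =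
      [set resolvent A w g | w in [set w | w \isn't Num.real]].
    have resE w : complex.Im w != 0 -> resolvent T w g = resolvent A w g.
      move=> w0; have [Dr Er] := resolventP ip_norm saA w0 (I : setT g).
      apply: (resolvent_unique saT) => //; first exact: (nonreal_regular ip_norm saT).
      by split=> //; exact: cyclic_generator.
    apply/seteqP; split=> _ [w w0 <-]; exists w => //=.
    - by rewrite nonrealE.
    - by rewrite resE.
    - by rewrite -nonrealE.
    - by rewrite resE // -nonrealE.
  by [].
pose K := [set t : R | ~ regular T t%:C].
pose U n := [set t : R |
  exists2 v, dom T v & n%:R * nrm (A v - t%:C *: v) < nrm (phi v)].
have oU n t : U n t -> exists2 d : R, 0 < d & forall y, `|y - t| < d -> U n y.
  move=> Ut; have := @unbounded_stage_open n; rewrite openE => /(_ t%:C Ut).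
  move=> /nbhs_nrmP[d d0 dU]; exists d => // y yt; apply: dU.
  by rewrite -rmorphB nrm_real distrC.
have dU n t (e : R) : K t -> 0 < e -> exists s, [/\ K s, `|s - t| < e & U n s].
  move=> Kt e0.
  have [s [st ns nb]] := phi_unbounded_near ip_norm saT
    (@cyclic_vector_in _ _ _ ip_norm _ A_sa g) phiT cyc e0 (ler0n R n) Kt.
  exists s; split=> //; apply: contrapT => nU; apply: nb => v Dv.
  by rewrite leNgt; apply/negP => h; apply: nU; exists v.
apply/closure_nrmP => e e0; have e20 : 0 < e / 2 by rewrite divr_gt0.
have [y [yz Uy]] := baire_on_subset oU dU nr e20.
exists y%:C; first by move=> n _; exact: Uy.
by rewrite zE -rmorphB nrm_real distrC; lra.
Qed.

Hypothesis phi_notH : ~ in_H ip A phi.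

(** If [g] were in [D(A)], then [phi] would be represented by [(A - i) g]. *)
Lemma vector_notin_dom : ~ dom A g.
Proof.
move=> Dg; apply: phi_notH; exists (A g - 'i%C *: g) => v Dv.
rewrite phi_repr // /inner ipDl ipZl ipBr ipZr (sa_sym saA) //.
by rewrite conjc_i mulNr opprK.
Qed.

(** [(A + i)^-1 phi = (A - i) (A + i)^-1 g]. *)
Lemma defect_vectorE : gen_resolvent ip A phi 'i%C = g ->
  defect_vector ip A phi = g - 'i%C *: resolvent A (conjc 'i%C) g.
Proof.
move=> gE; have [Dr Er] := resolventP ip_norm saA ic0 (I : setT g).
have ii := conjc_i R.
have ci : conjc (2 * 'i%C) = - (2 * 'i%C) :> R[i].
  by rewrite rmorphM rmorph_nat -mulrN -ii.
pose h := g - (2 * 'i%C) *: resolvent A (conjc 'i%C) g.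
have hP eta : inner ip h eta = phi (resolvent A (conjc (- 'i%C)) eta).
  have iE : conjc (- 'i%C) = 'i%C :> R[i].
    by apply/eqP; rewrite eq_complex /= oppr0 opprK !eqxx.
  have [Dh Eh] := resolventP ip_norm saA i0 (I : setT eta).
  rewrite iE phi_repr // (resolventE ip_norm saA i0) // /inner /h.
  rewrite ipBr ipZr -(resolvent_adj ip_norm saA i0) // !ipDl ipZl.
  by rewrite ci; ring.
have hE : gen_resolvent ip A phi (- 'i%C) = h.
  have := @xgetPex _ 0 [set h | forall eta, inner ip h eta =
    phi (resolvent A (conjc (- 'i%C)) eta)] (ex_intro _ h hP).
  rewrite -/(gen_resolvent ip A phi (- 'i%C)) => kP.
  set k := gen_resolvent _ _ _ _ in kP *; apply/eqP; rewrite -subr_eq0; apply/eqP.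
  apply: (orth_closure0 ip_norm (S := setT)); first exact: subset_closure.
  move=> x _; rewrite ipBr; apply/eqP; rewrite subr_eq0; apply/eqP.
  exact: etrans (kP x) (esym (hP x)).
rewrite /defect_vector gE hE /h.
move: (resolvent A _ g) => r.
have two : (2 : R[i]) != 0 by rewrite pnatr_eq0.
rewrite addrA -mulr2n scalerBr -[g *+ 2]scaler_nat !scalerA mulVf // scale1r.
by rewrite mulrA mulVf // mul1r.
Qed.

(** An eigenvector of [A] annihilated by [phi] is orthogonal to all
    [(A - z)^-1 g]. *)
Lemma eigenvector_phi_ne0 y (x : R) : M y -> y != 0 -> dom A y ->
  A y = x%:C *: y -> phi y <> 0.
Proof.
move=> My y0 Dy Ay phi0; move/eqP: y0; apply.
have gy : ip y g = 0.
  have := phi0; rewrite phi_repr // Ay -scalerDl ipZl => /eqP.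
  rewrite mulf_eq0 => /orP[|/eqP//]; rewrite eq_complex /= => /andP[_].
  by rewrite add0r oner_eq0.
have orth : M `<=` [set m | ip m y = 0].
  apply: (@cyclic_ind _ _ A g).
  - split=> [|a u v hu hv]; rewrite /mkset; first by rewrite ip0l.
    by rewrite ipDl ipZl hu hv mulr0 addr0.
  - by move=> m cm; apply: (orth_closure ip_norm _ cm).
  move=> z z0; rewrite /mkset (resolvent_adj ip_norm saA) //.
  have zc0 := Im_conj_neq0 z0.
  have zx : x%:C - conjc z != 0.
    by apply: contra zc0 => /eqP/subr0_eq <-; rewrite /=.
  have -> : resolvent A (conjc z) y = (x%:C - conjc z)^-1 *: y.
    apply: (resolvent_unique saA (nonreal_regular ip_norm saA zc0)).
      exact: subspaceZ.
    by rewrite (linear_onZ hD hA) // Ay !scalerA -scalerBl mulrC -mulrBl mulfV // scale1r.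
  by rewrite ipZr ipC gy conjc0 mulr0.
apply/nrm_eq0/eqP; rewrite -sqrf_eq0 -(rip_self ip_norm) /rip.
by rewrite [ip y y]orth.
Qed.

(** An eigenvector [y] at a real [x] satisfies [<y, (A - x) v> = k phi v] for
    some constant [k]. If [k <> 0], then [phi] is bounded by [A - x]; if
    [k = 0], then [y] is an eigenvector of [A] itself. Its component along the
    defect vector must vanish, as that vector is not in [D(A)], so the boundary
    condition gives [phi y = 0], which is impossible in [M]. *)
Lemma unbounded_not_eigenvalue (c alpha : R) (z : R[i]) :
  gen_resolvent ip A phi 'i%C = g -> unbounded_set z -> alpha != 0 ->
  ~ point_spectrum (op_restrict (perturbation ip A phi c alpha) M) z.
Proof.
move=> gE Gz alpha0 [y [[[adjy [u [b [Du yE bE]]]] My] y0 yz]].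
have [zE _] := spectrum_real saT (unbounded_spectrum Gz).
set x := complex.Re z in zE.
have orth v : dom A v -> phi v = 0 -> ip (A v - x%:C *: v) y = 0.
  move=> Dv pv; have := @xgetPex _ 0 _ adjy v (conj Dv pv).
  rewrite /inner [xget _ _]yz zE ipBl ipZl ipZr conjc_real => ->.
  by rewrite subrr.
have [v0 [Dv0 _] pv0] : exists2 v, dom T v & phi v != 0.
  have [v Dv h] := Gz 0%N I; exists v => //; apply/eqP => p0.
  by rewrite p0 nrm0 mul0r ltxx in h.
(* A functional that vanishes on the kernel of [phi] is a multiple of [phi]. *)
pose k := ip (A v0 - x%:C *: v0) y / phi v0.
have kE v : dom A v -> ip (A v - x%:C *: v) y = k * phi v.
  move=> Dv; pose a := phi v / phi v0.
  have Dw : dom A (v - a *: v0) by apply: (subspaceB hD) => //; exact: (subspaceZ _ hD).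
  have := orth _ Dw; rewrite (linear_onB hD phi_lin) //; last exact: (subspaceZ _ hD).
  rewrite (linear_onZ hD phi_lin) // /GRing.scale /= /a divfK // subrr => /(_ erefl).
  rewrite (linear_onB hD hA) //; last exact: (subspaceZ _ hD).
  rewrite (linear_onZ hD hA) //.
  have -> : A v - a *: A v0 - x%:C *: (v - a *: v0) =
      A v - x%:C *: v - a *: (A v0 - x%:C *: v0).
    by move: (A v) (A v0) => w w0; lincomb v v0 w w0; ring.
  by rewrite ipBl ipZl => /subr0_eq ->; rewrite /k /a; field.
have [k0|k0] := eqVneq k 0; last first.
  pose N := (Num.truncn (nrm y / nrm k)).+1.
  have nk := nrm_gt0 k0.
  have [w Tw] := Gz N I; apply/negP; rewrite -leNgt zE.
  have Dw : dom A w := Tw.1.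
  have := ip_CS ip_norm (A w - x%:C *: w) y; rewrite kE // nrmM => h.
  apply: (@le_trans _ _ (nrm y / nrm k * nrm (A w - x%:C *: w))); last first.
    by rewrite ler_wpM2r ?nrm_ge0 // ltW // truncnS_gt.
  by rewrite mulrAC ler_pdivlMr // mulrC [X in _ <= X]mulrC.
have [Dy Ay] : dom A y /\ A y = x%:C *: y.
  apply: (sa_adj saA) => // v Dv; have := kE v Dv; rewrite k0 mul0r ipBl ipZl.
  by move/subr0_eq => ->; rewrite ipZr conjc_real.
have [b0|b0] := eqVneq b 0.
  apply: (eigenvector_phi_ne0 My y0 Dy Ay).
  move: bE; rewrite yE b0 /ext_functional scale0r mul0r !addr0 add0r => /eqP.
  by rewrite mulf_eq0 fmorph_eq0 (negPf alpha0) => /eqP.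
apply: vector_notin_dom.
have [Dr _] := resolventP ip_norm saA ic0 (I : setT g).
have -> : g = b^-1 *: (y - u) + 'i%C *: resolvent A (conjc 'i%C) g.
  rewrite yE [u + _]addrC addrK scalerA mulVf // scale1r defect_vectorE //.
  by rewrite subrK.
apply: (subspaceD hD); last exact: (subspaceZ _ hD).
by apply: (subspaceZ _ hD); apply: (subspaceB hD).
Qed.

End Perturbation.

Lemma spectrum_zero_space (R : realType) (H : completeNormedModType R[i])
    (T : operator H) (z : R[i]) :
  dom T = [set 0] -> T 0 = 0 -> resolvent_set [set 0] T z.
Proof.
move=> dT T0; split.
  rewrite dT; split.
  - by move=> x ->; rewrite /= T0 scaler0 subr0.
  - by move=> x y /set_mem -> /set_mem ->.
  - by move=> y ->; exists 0; rewrite //= T0 scaler0 subr0.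
by exists 0 => x; rewrite dT => ->; rewrite normr0 mul0r.
Qed.

Lemma cyclic_space0 (R : realType) (H : completeNormedModType R[i])
    (ip : {dot H for Num.conj}) (A : operator H) :
  norm_of_inner ip -> self_adjoint ip A -> cyclic_space A 0 = [set 0].
Proof.
move=> ip_norm A_sa; have saA := self_adjoint_in_setT ip_norm A_sa.
apply/seteqP; split=> [|_ ->]; last by have [] := cyclic_subspace A (0 : H).
apply: (@cyclic_ind _ _ A 0).
- by split=> // a x y -> ->; rewrite scaler0 addr0.
- move=> x /closure_nrmP cx; apply: (@nrm_small0 _ _ _ 1) => e e0.
  by have [_ ->] := cx e e0; rewrite subr0 mul1r => /ltW.
- move=> z z0; apply: (linear_on0 (sa_sub saA)).
  exact: (resolvent_linear ip_norm saA z0).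
Qed.

Theorem theorem1p1 (R : realType) (H : completeNormedModType R[i])
    (ip : {dot H for Num.conj}) (ip_norm : norm_of_inner ip)
    (A : operator H) (A_sa : self_adjoint ip A)
    (phi : H -> R[i]) (phi_Hm2 : Hminus2 ip A phi) (phi_notH : ~ in_H ip A phi)
    (c : R) :
  let M := cyclic_space A (gen_resolvent ip A phi 'i) in
  let sigmaAM := spectrum M (op_restrict A M) in
  exists G : set R[i]^o,
    [/\ Gdelta G, G `<=` Xi ip A phi c & sigmaAM `<=` closure G].
Proof.
(* If no vector represents [(A - i)^-1 phi], then [gen_resolvent] takes its
   default value 0, and the spectrum of the part of [A] in [M = {0}] is empty. *)
have [[h hP]|noh] := pselect (exists h, forall eta : H,
    inner ip h eta = phi (resolvent A (conjc 'i%C) eta)).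
  pose g := gen_resolvent ip A phi 'i%C.
  have gP : forall eta : H, inner ip g eta = phi (resolvent A (conjc 'i%C) eta).
    exact: (@xgetPex _ 0 [set h | forall eta : H,
      inner ip h eta = phi (resolvent A (conjc 'i%C) eta)] (ex_intro _ h hP)).
  exists (unbounded_set A phi g); split.
  - exists (fun n => [set z : R[i]^o | exists2 v, dom (op_restrict A (cyclic_space A g)) v &
      n%:R * nrm (A v - z *: v) < nrm (phi v)]) => // n.
    exact: (@unbounded_stage_open _ _ A phi g n).
  - move=> z Gz; split; first exact: (unbounded_spectrum ip_norm A_sa gP).
    by move=> alpha; exact: (unbounded_not_eigenvalue ip_norm A_sa gP).
  - exact: (unbounded_dense ip_norm A_sa gP).
have -> : gen_resolvent ip A phi 'i%C = 0.
  by apply: xgetPN => h' hP; apply: noh; exists h'.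
exists set0; split=> //; first exact/open_Gdelta/open0.
rewrite (cyclic_space0 ip_norm A_sa) => z; case.
have [[hD hA] _ _] := A_sa.
apply: spectrum_zero_space; last exact: (linear_on0 hD hA).
by apply/seteqP; split=> [x []//|_ ->]; split=> //; exact: hD.1.
Qed.
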